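(* Let $\Lambda$ be an Artin algebra such that $\mathcal{P}^\infty(\Lambda\text{-mod})$ is contravariantly finite in $\Lambda\text{-mod}$, and let $A_1,\dots,A_n$ be the minimal $\mathcal{P}^\infty(\Lambda\text{-mod})$-approximations of the simple left $\Lambda$-modules (one for each isomorphism class of simple modules). Then $$\mathcal{P}^\infty(\Lambda\text{-Mod}) = \overrightarrow{\mathrm{filt}}(A_1,\dots,A_n).$$ In particular, each object of $\mathcal{P}^\infty(\Lambda\text{-Mod})$ is a direct limit of modules in $\mathcal{P}^\infty(\Lambda\text{-mod})$.
   Context: $\Lambda\text{-Mod}$ is the category of all left $\Lambda$-modules and $\Lambda\text{-mod}$ the category of finitely generated left $\Lambda$-modules. $\mathcal{P}^\infty(\Lambda\text{-mod})$ and $\mathcal{P}^\infty(\Lambda\text{-Mod})$ are the full subcategories of $\Lambda\text{-mod}$ and $\Lambda\text{-Mod}$, respectively, consisting of the modules of finite projective dimension. A full subcategory $\mathcal{A}$ of $\Lambda\text{-mod}$ is contravariantly finite in $\Lambda\text{-mod}$ if every $M\in\Lambda\text{-mod}$ has an $\mathcal{A}$-approximation, i.e. there are $A\in\mathcal{A}$ and a homomorphism $f:A\to M$ such that every homomorphism $B\to M$ with $B\in\mathcal{A}$ factors through $f$ (one also calls $A$ itself an $\mathcal{A}$-approximation of $M$). When they exist, the $\mathcal{P}^\infty(\Lambda\text{-mod})$-approximations of $M$ of minimal length are all isomorphic; any of these is called the minimal $\mathcal{P}^\infty(\Lambda\text{-mod})$-approximation of $M$. For $M_1,\dots,M_n\in\Lambda\text{-mod}$,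 $\mathrm{filt}(M_1,\dots,M_n)$ is the full subcategory of $\Lambda\text{-mod}$ whose objects are the finitely generated modules $X$ having a chain of submodules $X=X_0\supseteq X_1\supseteq\cdots\supseteq X_r=0$ such that each factor $X_i/X_{i+1}$ is isomorphic to some $M_j$. $\overrightarrow{\mathrm{filt}}(M_1,\dots,M_n)$ is the full subcategory of $\Lambda\text{-Mod}$ whose objects are the direct limits of modules in $\mathrm{filt}(M_1,\dots,M_n)$. Direct limits are colimits of directed systems (over directed index sets). *)

(* Defs.v *)
From HB Require Import structures.
From mathcomp Require Import all_boot all_order all_algebra.

Set Implicit Arguments.
Unset Strict Implicit.
Unset Printing Implicit Defensive.

Import GRing.Theory.

Local Open Scope ring_scope.
Local Open Scope quotient_scope.

(* Submodules are the library's [submodClosed M].  They are boolean predicates;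
   under the excluded middle this is no restriction. *)

Section SubmoduleType.
Variables (R : pzRingType) (M : lmodType R) (U : submodClosed M).

Record submod_of := Submod { submod_val : M; _ : submod_val \in U }.

HB.instance Definition _ := [isSub for submod_val].
HB.instance Definition _ := [Choice of submod_of by <:].
HB.instance Definition _ := [SubChoice_isSubLmodule of submod_of by <:].

End SubmoduleType.

Section QuotientModule.
Variables (R : pzRingType) (M : lmodType R) (U : submodClosed M).

(* [submodClosed] does not provide the closure under opposites that the
   library's quotient [{quot _}] expects; this copy of [U] does. *)
Definition submod_pred : {pred M} := fun x => x \in U.

Fact submod_pred_closed : subsemimod_closed submod_pred.
Proof. by split; [exact: (@rpred0D _ U) | exact: (@rpredZ _ _ U)]. Qed.

HB.instance Definition _ :=
  GRing.isSubmodClosed.Build R M submod_pred submod_pred_closed.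

Definition quotmod : Type := Quotient.quot submod_pred.

HB.instance Definition _ := GRing.Zmodule.on quotmod.
HB.instance Definition _ :=
  ZmodQuotient.on quotmod.

Definition quotmod_scale (a : R) (x : quotmod) : quotmod :=
  \pi_quotmod (a *: repr x).

Lemma quotmod_scale_pi a (x : M) :
  quotmod_scale a (\pi_quotmod x) = \pi_quotmod (a *: x).
Proof.
apply/eqP; rewrite -Quotient.idealrBE -scalerBr rpredZ //.
by rewrite Quotient.idealrBE reprK.
Qed.

Fact quotmod_scaleA a b x :
  quotmod_scale a (quotmod_scale b x) = quotmod_scale (a * b) x.
Proof. by rewrite -[x]reprK [quotmod_scale b _]quotmod_scale_pi !quotmod_scale_pi scalerA. Qed.

Fact quotmod_scale1 : left_id 1 quotmod_scale.
Proof. by move=> x; rewrite -[x]reprK quotmod_scale_pi scale1r. Qed.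

Fact quotmod_scaleDr : right_distributive quotmod_scale +%R.
Proof.
move=> a x y; rewrite -[x]reprK -[y]reprK -raddfD !quotmod_scale_pi.
by rewrite scalerDr raddfD.
Qed.

Fact quotmod_scaleDl x : {morph quotmod_scale^~ x : a b / a + b}.
Proof.
by move=> a b; rewrite -[x]reprK !quotmod_scale_pi scalerDl raddfD.
Qed.

HB.instance Definition _ := GRing.Zmodule_isLmodule.Build R quotmod
  quotmod_scaleA quotmod_scale1 quotmod_scaleDr quotmod_scaleDl.

Fact pi_quotmod_scalable : scalable \pi_quotmod.
Proof. by move=> a x; rewrite -quotmod_scale_pi. Qed.

HB.instance Definition _ :=
  GRing.isScalable.Build R M quotmod *:%R \pi_quotmod pi_quotmod_scalable.

End QuotientModule.

Section SubmoduleFactor.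
Variables (R : pzRingType) (M : lmodType R) (U V : submodClosed M).

Definition submod_in : {pred submod_of U} := fun x => val x \in V.

Fact submod_in_closed : subsemimod_closed submod_in.
Proof.
split=> [|a x xV]; first split=> [|x y xV yV].
- exact: (rpred0 V).
- exact: (rpredD (S := V) xV yV).
- exact: (rpredZ (s := V) a xV).
Qed.

HB.instance Definition _ :=
  GRing.isSubmodClosed.Build R (submod_of U) submod_in submod_in_closed.

(* U / (U :&: V), that is, U / V when V is contained in U. *)
Definition factmod : lmodType R := quotmod submod_in.

End SubmoduleFactor.

Arguments submod_in {R M} U V _.

Section Modules.
Variable R : pzRingType.
Implicit Types (A B F M N P Q X Y : lmodType R) (C : lmodType R -> Prop).

Definition mod_surjective M N (f : {linear M -> N}) : Prop :=
  forall y, exists x, f x = y.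

Definition mod_exact M N Q (f : {linear M -> N}) (g : {linear N -> Q}) : Prop :=
  forall y, g y = 0 <-> exists x, f x = y.

Definition mod_iso M N : Prop := exists f : {linear M -> N}, bijective f.

Definition fin_gen M : Prop :=
  exists (m : nat) (e : 'I_m -> M),
    forall x, exists c : 'I_m -> R, x = \sum_(i < m) c i *: e i.

Definition artinian_mod M : Prop :=
  forall U : nat -> submodClosed M,
    (forall i, {subset U i.+1 <= U i}) ->
    exists m, forall i, (m <= i)%N -> U i =i U m.

Definition simple_mod M : Prop :=
  (exists x : M, x != 0) /\
  forall U : submodClosed M, U =i pred1 (0 : M) \/ U =i predT.

Definition projective_mod P : Prop :=
  forall M N (g : {linear M -> N}) (f : {linear P -> N}),
    mod_surjective g -> exists h : {linear P -> M}, forall x, g (h x) = f x.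

(* An exact sequence 0 -> P_n -> ... -> P_1 -> P_0 -> M -> 0 with all P_i
   projective, extended by P_i = 0 for i > n. *)
Definition has_proj_resolution M (n : nat) : Prop :=
  exists (P : nat -> lmodType R)
         (d : forall i, {linear P i.+1 -> P i}) (e : {linear P 0%N -> M}),
    [/\ forall i, projective_mod (P i),
        forall i, (n < i)%N -> forall x : P i, x = 0,
        mod_surjective e,
        mod_exact (d 0%N) e &
        forall i, mod_exact (d i.+1) (d i)].

Definition finite_proj_dim M : Prop := exists n, has_proj_resolution M n.

(* A chain X = U 0 >= U 1 >= ... >= U r = 0 of submodules whose successive
   factors belong to C. *)
Definition has_filtration C X (r : nat) : Prop :=
  exists U : nat -> submodClosed X,
    [/\ U 0%N =i predT, U r =i pred1 (0 : X),
        forall i, (i < r)%N -> {subset U i.+1 <= U i} &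
        forall i, (i < r)%N -> C (factmod (U i) (U i.+1))].

Definition has_length X (l : nat) : Prop := has_filtration simple_mod X l.

Definition filt n (M : 'I_n -> lmodType R) X : Prop :=
  fin_gen X /\
  exists r, has_filtration (fun F => exists j, mod_iso F (M j)) X r.

Definition PinfMod M : Prop := finite_proj_dim M.
Definition Pinfmod M : Prop := fin_gen M /\ finite_proj_dim M.

Definition approximation C M A (f : {linear A -> M}) : Prop :=
  C A /\ forall B, C B -> forall g : {linear B -> M},
    exists h : {linear B -> A}, forall x, g x = f (h x).

Definition contravariantly_finite C : Prop :=
  forall M, fin_gen M -> exists A (f : {linear A -> M}), approximation C f.

Definition is_approximation C M A : Prop :=
  exists f : {linear A -> M}, approximation C f.

Definition minimal_approximation C M A : Prop :=
  is_approximation C M A /\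
  exists2 l, has_length A l &
    forall B m, is_approximation C M B -> has_length B m -> (l <= m)%N.

Definition simple_representatives n (S : 'I_n -> lmodType R) : Prop :=
  [/\ forall i, simple_mod (S i),
      forall i j, mod_iso (S i) (S j) -> i = j &
      forall M, simple_mod M -> exists i, mod_iso M (S i)].

Record directed_system := DirectedSystem {
  ds_disp : Order.disp_t;
  ds_index : preorderType ds_disp;
  ds_obj :> ds_index -> lmodType R;
  ds_map : forall i j, (i <= j)%O -> {linear ds_obj i -> ds_obj j};
  ds_nonempty : inhabited ds_index;
  ds_directed : forall i j : ds_index, exists k, (i <= k)%O /\ (j <= k)%O;
  ds_map_id : forall i (ii : (i <= i)%O) x, ds_map ii x = x;
  ds_map_comp :
    forall i j k (ij : (i <= j)%O) (jk : (j <= k)%O) (ik : (i <= k)%O) x,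
      ds_map jk (ds_map ij x) = ds_map ik x
}.

Definition is_cocone (D : directed_system) X
    (psi : forall i, {linear D i -> X}) : Prop :=
  forall i j (ij : (i <= j)%O) x, psi j (ds_map ij x) = psi i x.

Definition is_direct_limit (D : directed_system) X
    (psi : forall i, {linear D i -> X}) : Prop :=
  is_cocone psi /\
  forall Y (chi : forall i, {linear D i -> Y}), is_cocone chi ->
    (exists u : {linear X -> Y}, forall i x, u (psi i x) = chi i x) /\
    (forall u v : {linear X -> Y},
       (forall i x, u (psi i x) = chi i x) ->
       (forall i x, v (psi i x) = chi i x) -> u =1 v).

Definition direct_limits_of C X : Prop :=
  exists2 D : directed_system, forall i, C (D i) &
    exists psi : forall i, {linear D i -> X}, is_direct_limit psi.

End Modules.

Definition artinian_ring (k : pzRingType) : Prop := artinian_mod (k^o : lmodType k).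

Definition artin_algebra (k : comNzRingType) (L : algType k) : Prop :=
  artinian_ring k /\ fin_gen (L : lmodType k).

(* Main.v *)
(* Let C be the class of finitely generated modules of finite projective
   dimension.  By Wakamatsu's lemma the kernel Y_i of A_i -> S_i satisfies
   Ext^1(C, Y_i) = 0.  Every module X has a finite filtration with semisimple
   factors, so a horseshoe argument yields an exact sequence
   0 -> Y -> M -> X -> 0, where M (resp. Y) has a finite filtration whose factors
   are arbitrary direct sums of the A_i (resp. of the Y_i).
   Suppose that every map from a finitely generated module to X factors through
   C.  The Y_i have finite length over the base ring, so direct sums of them have
   the descending chain condition on pp-definable subgroups, and the usual
   argument for algebraic compactness gives Ext^1(X, Y) = 0.  Hence X is a direct
   summand of M.  Now M is a directed union of submodules in filt(A), so maps to X
   factor through filt(A), and X is a direct limit of such modules as in Lazard's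
   theorem; also M, hence X, has finite projective dimension.
   That modules of finite projective dimension satisfy the factorization property
   is shown by induction on the dimension, writing X = P / K where K is already
   known to be a direct summand of a directed union of modules in C. *)
Require Import Defs.
From HB Require Import structures.
From mathcomp Require Import all_boot all_order all_algebra.
From mathcomp Require Import boolp classical_sets.
From mathcomp Require Import zify ring.

Set Implicit Arguments.
Unset Strict Implicit.
Unset Printing Implicit Defensive.

Import GRing.Theory.
Local Open Scope ring_scope.
Local Open Scope quotient_scope.

(** * Submodules, quotients, pushouts *)

Section Submodules.
Variable R : pzRingType.
Implicit Types A B C D E F K M N P Q U V W X Y Z : lmodType R.

(** Wakamatsu's lemma tests the [Y_i] only against finitely generated modules, while [X] is
    arbitrary; this gap is the main obstacle. A lift of a map defined on [X] has to be assembled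
    from finite pieces, one element at a time, and the chain condition allows the value at a new
    element to be chosen compatibly with all finite data at once. The condition is rooted in the
    base ring: descending chains of ideals give finite length of [k], hence a rank on the
    [k]-submodules of every finitely generated [L]-module, and pp-subgroups are [k]-submodules. The
    induction carries the factorization property instead of finite projective dimension. It is what
    the compactness argument consumes, it passes to direct summands, and for modules in [filt A] it
    is equivalent to being a direct limit. Since there are only finitely many [A_i], one bound on
    their projective dimensions serves every [X]. *)

Definition mklin M N (F : M -> N) (H : linear F) : {linear M -> N} :=
  HB.pack F (GRing.isLinear.Build R M N *:%R F H).

(** Submodules are handled as classical sets, so that kernels, images and spans are plain
    propositions; [mksub] returns to the boolean form of the definitions. *)
Definition smod M (U : set M) : Prop :=
  [/\ U 0, forall x y, U x -> U y -> U (x + y) & forall a x, U x -> U (a *: x)].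

Section MkSub.
Variables (M : lmodType R) (U : set M) (HU : smod U).
Definition mksub_pred : {pred M} := fun x => `[< U x >].
Fact mksub_closed : subsemimod_closed mksub_pred.
Proof.
case: HU => U0 UD UZ.
split=> [|a x /asboolP xU]; last exact/asboolP/UZ.
split=> [|x y /asboolP xU /asboolP yU]; first exact/asboolP.
exact/asboolP/UD.
Qed.
Definition mksub : submodClosed M :=
  HB.pack_for (submodClosed M) mksub_pred
    (GRing.isSubmodClosed.Build R M mksub_pred mksub_closed).
Lemma mksubP x : reflect (U x) (x \in mksub).
Proof. exact: asboolP. Qed.
End MkSub.

Lemma submod_smod M (U : submodClosed M) : smod (fun x => x \in U).
Proof.
by split=> [|x y|a x]; [exact: (rpred0 U) | exact: (rpredD (S := U)) | exact: (rpredZ (s := U))].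
Qed.

Lemma linZD M N (f : {linear M -> N}) a x y : f (a *: x + y) = a *: f x + f y.
Proof. exact: linearP. Qed.

Lemma smodB M (U : set M) : smod U -> forall x y, U x -> U y -> U (x - y).
Proof. by case=> _ UD UZ x y Ux Uy; apply: UD => //; rewrite -scaleN1r; apply: UZ. Qed.

Lemma smod_sum M (U : set M) (I : Type) (r : seq I) (F : I -> M) :
  smod U -> (forall i, U (F i)) -> U (\sum_(i <- r) F i).
Proof. by case=> U0 UD _ UF; elim/big_rec: _ => // i x _; apply: UD. Qed.

Lemma smod_ker M N (f : {linear M -> N}) : smod (fun x => f x = 0).
Proof.
by split=> [|x y fx fy|a x fx]; rewrite ?linear0 // ?linearD ?linearZ /= ?fx ?fy ?addr0 ?scaler0.
Qed.

Lemma smod_image M N (f : {linear M -> N}) (U : set M) :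
  smod U -> smod (fun y => exists2 x, U x & f x = y).
Proof.
case=> U0 UD UZ; split=> [|_ _ [x Ux <-] [y Uy <-]|a _ [x Ux <-]].
- by exists 0; rewrite ?linear0.
- by exists (x + y); rewrite ?linearD //; apply: UD.
- by exists (a *: x); rewrite ?linearZ //; apply: UZ.
Qed.

Lemma smod_range M N (f : {linear M -> N}) : smod (fun y => exists x, f x = y).
Proof.
split=> [|_ _ [x <-] [y <-]|a _ [x <-]].
- by exists 0; rewrite linear0.
- by exists (x + y); rewrite linearD.
- by exists (a *: x); rewrite linearZ.
Qed.

Lemma smod_preim M N (f : {linear M -> N}) (U : set N) :
  smod U -> smod (fun x => U (f x)).
Proof.
case=> U0 UD UZ; split=> [|x y Ux Uy|a x Ux]; rewrite ?linear0 ?linearD ?linearZ //=.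
  exact: UD.
exact: UZ.
Qed.

Lemma smodI M (U V : set M) : smod U -> smod V -> smod (fun x => U x /\ V x).
Proof.
case=> U0 UD UZ [V0 VD VZ]; split=> // [x y [Ux Vx] [Uy Vy]|a x [Ux Vx]].
  by split; [apply: UD | apply: VD].
by split; [apply: UZ | apply: VZ].
Qed.

(** Together with [ex_quot] this hides the concrete subtypes and quotients: a submodule is used
    through an injection with given image, a quotient through a surjection with given kernel. *)
Lemma ex_sub M (U : set M) : smod U ->
  exists (K : lmodType R) (i : {linear K -> M}),
    injective i /\ forall y, U y <-> exists x, i x = y.
Proof.
move=> HU; exists (submod_of (mksub HU)), val; split; first exact: val_inj.
move=> y; split=> [Uy|[x <-]]; last exact/mksubP/(valP x).
by exists (Submod (introT (mksubP HU y) Uy)).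
Qed.

Lemma pi_quotmod0 M (U : submodClosed M) (x : M) :
  (\pi_(quotmod U) x = 0 :> quotmod U) <-> x \in U.
Proof.
rewrite -[0](raddf0 \pi_(quotmod U)); split=> [/eqP|xU].
  by rewrite -Quotient.idealrBE subr0.
by apply/eqP; rewrite -Quotient.idealrBE subr0.
Qed.

Lemma ex_quot M (U : set M) : smod U ->
  exists (Q : lmodType R) (g : {linear M -> Q}),
    mod_surjective g /\ forall x, g x = 0 <-> U x.
Proof.
move=> HU; exists (quotmod (mksub HU)), \pi_(quotmod (mksub HU)); split.
  by move=> y; exists (repr y); exact: (reprK y).
move=> x; rewrite pi_quotmod0; split=> [/mksubP//|Ux]; exact/mksubP.
Qed.

Lemma factor_surj M N Q (g : {linear M -> N}) (h : {linear M -> Q}) :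
  mod_surjective g -> (forall x, g x = 0 -> h x = 0) ->
  exists h' : {linear N -> Q}, forall x, h' (g x) = h x.
Proof.
move=> /choice[s gs] kh.
have hE x y : g x = g y -> h x = h y.
  by move=> e; apply/eqP; rewrite -subr_eq0 -linearB kh // linearB /= e subrr.
have hl : linear (h \o s).
  by move=> a x y /=; rewrite -linZD; apply: hE; rewrite linZD !gs.
by exists (mklin hl) => x /=; apply: hE; rewrite gs.
Qed.

Lemma factor_inj M N Q (f : {linear M -> N}) (h : {linear Q -> N}) :
  injective f -> (forall x, exists y, f y = h x) ->
  exists h' : {linear Q -> M}, forall x, f (h' x) = h x.
Proof.
move=> fI /choice[s fs].
have sl : linear s by move=> a x y; apply: fI; rewrite linZD !fs linZD.
by exists (mklin sl).
Qed.

Lemma inj_of_ker M N (f : {linear M -> N}) : (forall x, f x = 0 -> x = 0) -> injective f.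
Proof. by move=> k x y e; apply/eqP; rewrite -subr_eq0; apply/eqP/k; rewrite linearB /= e subrr. Qed.

Definition ses X M Q (f : {linear X -> M}) (g : {linear M -> Q}) : Prop :=
  [/\ injective f, mod_exact f g & mod_surjective g].

Lemma ses_zero X M Q (f : {linear X -> M}) (g : {linear M -> Q}) :
  ses f g -> forall x, g (f x) = 0.
Proof. by case=> _ ex _ x; apply/ex; exists x. Qed.

Lemma ses_ker M Q (g : {linear M -> Q}) : mod_surjective g ->
  exists (K : lmodType R) (f : {linear K -> M}), ses f g.
Proof. by move=> gs; have [K [f [fI fP]]] := ex_sub (smod_ker g); exists K, f. Qed.

Lemma ses_coker X M (f : {linear X -> M}) : injective f ->
  exists (Q : lmodType R) (g : {linear M -> Q}), ses f g.
Proof.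
move=> fI; have [Q [g [gs gP]]] := ex_quot (smod_range f).
by exists Q, g; split.
Qed.

Definition is0 M := forall x : M, x = 0.
Lemma ses_id M (Z : lmodType R) : is0 Z -> ses (\0 : {linear Z -> M}) (idfun : {linear M -> M}).
Proof.
move=> Z0; split=> [x y _|y|y]; first by rewrite (Z0 x) (Z0 y).
  by split=> /= [->|[x]//]; exists 0.
by exists y.
Qed.

Definition retract X M : Prop :=
  exists (s : {linear X -> M}) (r : {linear M -> X}), cancel s r.

Lemma bij_lin_inv M N (f : {linear M -> N}) : bijective f ->
  exists g : {linear N -> M}, cancel f g /\ cancel g f.
Proof.
case=> g fg gf; have gl : linear g.
  by move=> a x y; apply: (can_inj fg); rewrite linZD !gf.
by exists (mklin gl).
Qed.

Lemma inj_surj_bij M N (f : {linear M -> N}) : injective f -> mod_surjective f -> bijective f.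
Proof. by move=> fI /choice[g gf]; exists g => // x; apply: fI; rewrite gf. Qed.

Lemma mod_iso_sym M N : mod_iso M N -> mod_iso N M.
Proof. by case=> f /bij_lin_inv[g [fg gf]]; exists g; exists f. Qed.

Lemma mod_iso_retract M N : mod_iso M N -> retract M N.
Proof. by case=> f /bij_lin_inv[g [fg gf]]; exists f, g. Qed.

Section PairMaps.
Variables X Y Z : lmodType R.
Definition lin_pair (f : {linear X -> Y}) (g : {linear X -> Z}) : {linear X -> (Y * Z)%type}.
Proof.
apply: (@mklin _ _ (fun x => (f x, g x))) => a x y.
by rewrite !linZD.
Defined.
Definition lin_copair (f : {linear X -> Z}) (g : {linear Y -> Z}) : {linear (X * Y)%type -> Z}.
Proof.
apply: (@mklin _ _ (fun p => f p.1 + g p.2)) => a x y /=.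
by rewrite !linZD scalerDr addrACA.
Defined.
End PairMaps.

Fact linscale_subproof M (x : M) : linear (fun a : (R^o : lmodType R) => (a : R) *: x : M).
Proof. by move=> a b c; rewrite scalerDl scalerA. Qed.
Definition linscale M (x : M) : {linear (R^o : lmodType R) -> M} := mklin (linscale_subproof x).

(** The pushout is the quotient of the product of [Q] and [C] by the pairs [(i x, - u x)]. The
    conclusion exports only what later arguments use, so the construction stays hidden. *)
Lemma pushout_ses U Q D C (i : {linear U -> Q}) (g : {linear Q -> D}) (u : {linear U -> C}) :
  ses i g -> exists (P : lmodType R) (p : {linear Q -> P}) (j : {linear C -> P}) (q : {linear P -> D}),
    [/\ ses j q, (forall x, p (i x) = j (u x)), (forall x, q (p x) = g x),
        (forall z, exists x y, z = p x + j y) &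
        forall X (a : {linear Q -> X}) (b : {linear C -> X}), (forall x, a (i x) = b (u x)) ->
          exists h : {linear P -> X}, (forall x, h (p x) = a x) /\ (forall y, h (j y) = b y)].
Proof.
move=> [iI ex gs].
pose d := lin_pair i (\- u).
have [P [w [ws wP]]] := ex_quot (smod_range d).
pose p := w \o lin_pair idfun \0 : {linear Q -> P}.
pose j := w \o lin_pair \0 idfun : {linear C -> P}.
have wE x y : w (x, y) = p x + j y.
  by rewrite /p /j /= -linearD /= -[RHS]/(w (x + 0, 0 + y)) addr0 add0r.
have pi x : p (i x) = j (u x).
  apply/eqP; rewrite -subr_eq0 -linearN /= -wE; apply/eqP/wP.
  by exists x.
have univ X (a : {linear Q -> X}) (b : {linear C -> X}) : (forall x, a (i x) = b (u x)) ->
    exists h : {linear P -> X}, (forall x, h (p x) = a x) /\ (forall y, h (j y) = b y).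
  move=> ab; have [h hP] : exists h : {linear P -> X}, forall z, h (w z) = lin_copair a b z.
    apply: factor_surj ws _ => z /wP[x <-] /=.
    by rewrite linearN /= ab subrr.
  by exists h; split=> x; rewrite hP /= ?linear0 ?addr0 ?add0r.
have [q [qp qj]] := univ D g \0 (fun x => proj2 (ex (i x)) (ex_intro _ x erefl)).
have span z : exists x y, z = p x + j y by have [[x y] <-] := ws z; exists x, y; rewrite wE.
have jI : injective j.
  apply: inj_of_ker => y /wP[x] /= [] ix0 <-.
  have -> : x = 0 by apply: iI; rewrite ix0 linear0.
  by rewrite linear0 oppr0.
clear wE; clearbody p j.
exists P, p, j, q; split=> //; split=> //.
- move=> z; split=> [|[y <-]]; last exact: qj.
  have [x [y ->]] := span z; rewrite linearD /= qp qj addr0 => /ex[x' <-].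
  by exists (u x' + y); rewrite linearD /= pi.
- by move=> e; have [x <-] := gs e; exists (p x).
Qed.

End Submodules.

(** * Direct sums and free modules *)

Lemma dep_choice (I : Type) (T : I -> Type) (P : forall i, T i -> Prop) :
  (forall i, exists x, P i x) -> exists f : forall i, T i, forall i, P i (f i).
Proof. by move=> h; exists (fun i => projT1 (cid (h i))) => i; case: cid. Qed.

Section Products.
Variables (R : pzRingType) (I : Type) (M : I -> lmodType R).

Definition dprod : Type := forall i, M i.

HB.instance Definition _ := gen_eqMixin dprod.
HB.instance Definition _ := gen_choiceMixin dprod.

Definition dprod_zero : dprod := fun=> 0.
Definition dprod_opp (x : dprod) : dprod := fun i => - x i.
Definition dprod_add (x y : dprod) : dprod := fun i => x i + y i.
Definition dprod_scale (a : R) (x : dprod) : dprod := fun i => a *: x i.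

Fact dprod_addA : associative dprod_add.
Proof. by move=> x y z; apply: functional_extensionality_dep => i; apply: addrA. Qed.
Fact dprod_addC : commutative dprod_add.
Proof. by move=> x y; apply: functional_extensionality_dep => i; apply: addrC. Qed.
Fact dprod_add0 : left_id dprod_zero dprod_add.
Proof. by move=> x; apply: functional_extensionality_dep => i; apply: add0r. Qed.
Fact dprod_addN : left_inverse dprod_zero dprod_opp dprod_add.
Proof. by move=> x; apply: functional_extensionality_dep => i; apply: addNr. Qed.

HB.instance Definition _ :=
  GRing.isZmodule.Build dprod dprod_addA dprod_addC dprod_add0 dprod_addN.

Fact dprod_scaleA a b x : dprod_scale a (dprod_scale b x) = dprod_scale (a * b) x.
Proof. by apply: functional_extensionality_dep => i; apply: scalerA. Qed.
Fact dprod_scale1 : left_id 1 dprod_scale.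
Proof. by move=> x; apply: functional_extensionality_dep => i; apply: scale1r. Qed.
Fact dprod_scaleDr : right_distributive dprod_scale +%R.
Proof. by move=> a x y; apply: functional_extensionality_dep => i; apply: scalerDr. Qed.
Fact dprod_scaleDl x : {morph dprod_scale^~ x : a b / a + b}.
Proof. by move=> a b; apply: functional_extensionality_dep => i; apply: scalerDl. Qed.

HB.instance Definition _ := GRing.Zmodule_isLmodule.Build R dprod
  dprod_scaleA dprod_scale1 dprod_scaleDr dprod_scaleDl.

End Products.

Section DirectSums.
Variables (R : pzRingType) (I : eqType) (M : I -> lmodType R).

Definition fin_supp : set (dprod M) := fun x => exists s : seq I, forall i, i \notin s -> x i = 0.

Fact fin_supp_smod : smod fin_supp.
Proof.
split=> [|x y [s sx] [t ty]|a x [s sx]].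
- by exists [::].
- exists (s ++ t) => i; rewrite mem_cat negb_or => /andP[/sx xi /ty yi].
  by rewrite -[LHS]/(x i + y i) xi yi addr0.
- by exists s => i /sx xi; rewrite -[LHS]/(a *: x i) xi scaler0.
Qed.

Definition dsum : lmodType R := submod_of (mksub fin_supp_smod).

Fact dpr_linear i : linear (fun x : dsum => val x i).
Proof. by []. Qed.

Fact dpr_exists i : exists f : {linear dsum -> M i}, forall x, f x = val x i.
Proof. by exists (mklin (dpr_linear i)). Qed.

(** Drawn from an opaque existence proof, so that simplification never unfolds the projections to
    the underlying subtype; [dinj] is treated alike. *)
Definition dpr i : {linear dsum -> M i} := projT1 (cid (dpr_exists i)).

Lemma dprE i x : dpr i x = val x i.
Proof. by rewrite /dpr; case: cid. Qed.

Lemma dsum_ext (x y : dsum) : (forall i, dpr i x = dpr i y) -> x = y.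
Proof.
move=> e; apply: val_inj.
have h : (val x : forall i, M i) = val y.
  by apply: functional_extensionality_dep => i; have := e i; rewrite !dprE.
exact: h.
Qed.

Lemma dsum_supp (x : dsum) : exists s : seq I, forall i, i \notin s -> dpr i x = 0.
Proof. by have /mksubP[s sP] := valP x; exists s => i; rewrite dprE => /sP. Qed.

Lemma dsum_build (z : forall i, M i) (s : seq I) :
  (forall i, i \notin s -> z i = 0) -> exists x : dsum, forall i, dpr i x = z i.
Proof.
move=> zs; have zf : (z : dprod M) \in mksub fin_supp_smod by apply/mksubP; exists s.
by exists (Submod zf) => i; rewrite dprE.
Qed.

(** The summands depend on the index, so the value at [j] is a transport along [i = j]; it
    disappears at [j := i] because equality on [I] is decidable. *)
Definition dinj_fun i (x : M i) : forall j, M j :=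
  fun j => if @eqP _ i j is ReflectT e then eq_rect i M x j e else 0.

Lemma dinj_fun_id i (x : M i) : dinj_fun x i = x.
Proof. by rewrite /dinj_fun; case: eqP => // e; rewrite eq_axiomK. Qed.

Lemma dinj_fun_neq i j (x : M i) : i != j -> dinj_fun x j = 0.
Proof. by rewrite /dinj_fun; case: eqP. Qed.

Fact dinj_exists i : exists f : {linear M i -> dsum}, forall x j, dpr j (f x) = dinj_fun x j.
Proof.
have /choice[f fP] (x : M i) : exists y : dsum, forall j, dpr j y = dinj_fun x j.
  by apply: (dsum_build (s := [:: i])) => j; rewrite inE eq_sym; apply: dinj_fun_neq.
have fl : linear f.
  move=> a x y; apply: dsum_ext => j; rewrite linZD !fP /dinj_fun.
  by case: eqP => [e|]; [case: j / e | rewrite scaler0 addr0].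
by exists (mklin fl).
Qed.

Definition dinj i : {linear M i -> dsum} := projT1 (cid (dinj_exists i)).

Lemma dpr_dinjE i x j : dpr j (dinj i x) = dinj_fun x j.
Proof. by rewrite /dinj; case: cid. Qed.

Lemma dpr_dinj i x : dpr i (dinj i x) = x.
Proof. by rewrite dpr_dinjE dinj_fun_id. Qed.

Lemma dpr_dinj_neq i j x : i != j -> dpr j (dinj i x) = 0.
Proof. by rewrite dpr_dinjE; apply: dinj_fun_neq. Qed.

Lemma dpr_sum_dinj (z : forall i, M i) (s : seq I) j : uniq s ->
  dpr j (\sum_(i <- s) dinj i (z i)) = if j \in s then z j else 0.
Proof.
move=> us; rewrite linear_sum; case: ifPn => js.
  rewrite (bigD1_seq j) //= dpr_dinj big1 ?addr0 // => i ij.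
  exact: dpr_dinj_neq.
rewrite big_seq big1 // => i iS; apply: dpr_dinj_neq.
by apply: contraNneq js => <-.
Qed.

Lemma dsum_decomp (x : dsum) (s : seq I) : uniq s ->
  (forall i, i \notin s -> dpr i x = 0) -> x = \sum_(i <- s) dinj i (dpr i x).
Proof.
move=> us sx; apply: dsum_ext => j.
by rewrite (dpr_sum_dinj (fun i => dpr i x) j us); case: ifPn => // /sx.
Qed.

Lemma dsum_suppu (x : dsum) : exists2 s : seq I, uniq s & forall i, i \notin s -> dpr i x = 0.
Proof.
have [s sP] := dsum_supp x; exists (undup s); first exact: undup_uniq.
by move=> i; rewrite mem_undup; apply: sP.
Qed.

Lemma dsum_hom_ext_on (N : lmodType R) (f g : {linear dsum -> N}) (s : seq I) (x : dsum) :
  (forall i, i \notin s -> dpr i x = 0) ->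
  (forall i y, i \in s -> f (dinj i y) = g (dinj i y)) -> f x = g x.
Proof.
move=> sx fg; have E : x = \sum_(i <- undup s) dinj i (dpr i x).
  by apply: dsum_decomp (undup_uniq s) _ => i; rewrite mem_undup; apply: sx.
by rewrite [in LHS]E [in RHS]E !linear_sum !big_seq; apply: eq_bigr => i; rewrite mem_undup => /fg.
Qed.

Lemma dsum_hom_ext (N : lmodType R) (f g : {linear dsum -> N}) :
  (forall i y, f (dinj i y) = g (dinj i y)) -> f =1 g.
Proof. by move=> fg x; have [s sx] := dsum_supp x; exact: (dsum_hom_ext_on sx). Qed.

Lemma dsum_lift (N : lmodType R) (h : forall i, {linear M i -> N}) :
  exists f : {linear dsum -> N}, forall i x, f (dinj i x) = h i x.
Proof.
have /choice[sp spP] (x : dsum) : exists s : seq I, uniq s /\ forall i, i \notin s -> dpr i x = 0.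
  by have [s] := dsum_suppu x; exists s.
pose F x := \sum_(i <- sp x) h i (dpr i x).
(* [F] sums over a chosen support. Any other support gives the same value, since both sums reduce to
   the common part; linearity then follows on a support shared by the arguments. *)
have FE x s : uniq s -> (forall i, i \notin s -> dpr i x = 0) -> F x = \sum_(i <- s) h i (dpr i x).
  have [ut xt] := spP x; rewrite /F; move: (sp x) ut xt => t ut xt us xs.
  have cut (a b : seq I) : (forall i, i \notin b -> dpr i x = 0) ->
      \sum_(i <- a) h i (dpr i x) = \sum_(i <- a | i \in b) h i (dpr i x).
    move=> xb; rewrite big_mkcond [RHS]big_mkcond /=; apply: eq_bigr => i _.
    by case: ifPn => // /xb ->; rewrite linear0.
  apply: etrans (cut t s xs) (etrans _ (esym (cut s t xt))).
  rewrite -[LHS]big_filter -[RHS]big_filter; apply: perm_big.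
  apply: uniq_perm; rewrite ?filter_uniq // => i.
  by rewrite !mem_filter andbC.
have Fl : linear F.
  move=> a x y; pose s := undup (sp x ++ sp y).
  have us : uniq s := undup_uniq _.
  have xs i : i \notin s -> dpr i x = 0.
    by rewrite mem_undup mem_cat negb_or => /andP[/(proj2 (spP x))].
  have ys i : i \notin s -> dpr i y = 0.
    by rewrite mem_undup mem_cat negb_or => /andP[_ /(proj2 (spP y))].
  rewrite !(FE _ s) // => [|i js]; last by rewrite linZD xs // ys // scaler0 addr0.
  by rewrite scaler_sumr -big_split; apply: eq_bigr => i _; rewrite !linZD.
exists (mklin Fl) => i x /=; rewrite (FE _ [:: i]) // => [|j].
  by rewrite big_seq1 dpr_dinj.
by rewrite inE eq_sym; apply: dpr_dinj_neq.
Qed.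

(** A family of maps always lands in the product; the common finite support [s] brings it into the
    direct sum. *)
Lemma dsum_colift (N : lmodType R) (h : forall i, {linear N -> M i}) (s : seq I) :
  (forall i, i \notin s -> forall x, h i x = 0) ->
  exists f : {linear N -> dsum}, forall x i, dpr i (f x) = h i x.
Proof.
move=> hs.
have /choice[f fP] (x : N) : exists y : dsum, forall j, dpr j y = h j x.
  by apply: (dsum_build (s := s)) => j /hs.
have fl : linear f by move=> a x y; apply: dsum_ext => j; rewrite linZD !fP linZD.
by exists (mklin fl).
Qed.

Lemma fin_gen_dsum_supp (N : lmodType R) (f : {linear N -> dsum}) : fin_gen N ->
  exists s : seq I, forall x i, i \notin s -> dpr i (f x) = 0.
Proof.
move=> [m [e eP]].
have /choice[sp spP] (t : 'I_m) := dsum_supp (f (e t)).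
exists (flatten [seq sp t | t <- enum 'I_m]) => x i ni.
have [c ->] := eP x; rewrite linear_sum linear_sum big1 // => t _.
rewrite !linearZ /= spP ?scaler0 //; apply: contra ni => ni.
by apply/flattenP; exists (sp t) => //; apply: map_f; rewrite mem_enum.
Qed.

End DirectSums.

Section DirectSumMaps.
Variables (R : pzRingType) (I : eqType).

Lemma dsum_map (M N : I -> lmodType R) (h : forall i, {linear M i -> N i}) :
  exists f : {linear dsum M -> dsum N},
    (forall i x, f (dinj M i x) = dinj N i (h i x)) /\ (forall i x, dpr N i (f x) = h i (dpr M i x)).
Proof.
have [f fP] := dsum_lift (fun i => dinj N i \o h i : {linear _ -> _}).
exists f; split=> // i.
apply: (dsum_hom_ext (f := dpr N i \o f) (g := h i \o dpr M i)) => j y /=.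
rewrite fP /=; case: (eqVneq j i) => [e|ne]; last by rewrite !dpr_dinj_neq // linear0.
by case: i / e; rewrite !dpr_dinj.
Qed.

Lemma dsum_ses (A B C : I -> lmodType R) (f : forall i, {linear A i -> B i})
    (g : forall i, {linear B i -> C i}) : (forall i, ses (f i) (g i)) ->
  exists (F : {linear dsum A -> dsum B}) (G : {linear dsum B -> dsum C}),
    [/\ ses F G, (forall i x, dpr B i (F x) = f i (dpr A i x)) & (forall i x, dpr C i (G x) = g i (dpr B i x))].
Proof.
move=> fg; have [F [_ FP]] := dsum_map f; have [G [_ GP]] := dsum_map g.
exists F, G; split=> //; split.
- apply: inj_of_ker => x Fx; apply: dsum_ext => i.
  by have [fI _ _] := fg i; apply: fI; rewrite -FP Fx !linear0.
- move=> y; split=> [Gy|[x <-]]; last first.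
    by apply: dsum_ext => i; rewrite GP FP (ses_zero (fg i)) linear0.
  have /dep_choice[z zP] i : exists x, f i x = dpr B i y.
    by have [_ ex _] := fg i; apply/ex; rewrite -GP Gy linear0.
  have [s sy] := dsum_supp y.
  have [x xP] : exists x, forall i, dpr A i x = z i.
    apply: (dsum_build (s := s)) => i /sy yi.
    by have [fI _ _] := fg i; apply: fI; rewrite zP yi linear0.
  by exists x; apply: dsum_ext => i; rewrite FP xP zP.
- move=> c.
  have [s sc] := dsum_supp c.
  have /dep_choice[z zP] i : exists x, g i x = dpr C i c /\ (i \notin s -> x = 0).
    case: (boolP (i \in s)) => [_|/sc->]; last by exists 0; rewrite linear0.
    by have [_ _ /(_ (dpr C i c))[x]] := fg i; exists x.
  have [x xP] := dsum_build (fun i ni => proj2 (zP i) ni).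
  by exists x; apply: dsum_ext => i; rewrite GP xP (proj1 (zP i)).
Qed.

End DirectSumMaps.

Definition freemod (R : pzRingType) (I : eqType) : lmodType R := dsum (fun _ : I => R^o : lmodType R).

Section Free.
Variables (R : pzRingType) (I : eqType).
Definition fbas (i : I) : freemod R I := dinj _ i (1 : R^o).

Lemma free_lift (M : lmodType R) (e : I -> M) :
  exists f : {linear freemod R I -> M}, forall i, f (fbas i) = e i.
Proof.
have [f fP] := dsum_lift (fun i => linscale (e i)).
by exists f => i; rewrite fP /= scale1r.
Qed.

Lemma dinj_fbas i (a : R^o) : dinj (fun _ : I => R^o : lmodType R) i a = (a : R) *: fbas i.
Proof.
rewrite -linearZ; congr (dinj _ i _); by rewrite -[RHS]/(a * 1) mulr1.
Qed.

Lemma free_hom_ext_on (N : lmodType R) (f g : {linear freemod R I -> N}) (s : seq I) x :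
  (forall i, i \notin s -> dpr (fun _ : I => R^o : lmodType R) i x = 0) ->
  (forall i, i \in s -> f (fbas i) = g (fbas i)) -> f x = g x.
Proof.
move=> xs fg; apply: (dsum_hom_ext_on xs) => i y si.
by rewrite dinj_fbas !linearZ /= fg.
Qed.

Lemma free_hom_ext (N : lmodType R) (f g : {linear freemod R I -> N}) :
  (forall i, f (fbas i) = g (fbas i)) -> f =1 g.
Proof.
move=> fg; apply: dsum_hom_ext => i y; by rewrite dinj_fbas !linearZ /= fg.
Qed.

Lemma free_projective : projective_mod (freemod R I).
Proof.
move=> M N g f /choice[s gs].
have [h hP] := free_lift (fun i => s (f (fbas i))).
exists h; apply: (free_hom_ext (f := g \o h)) => i /=.
by rewrite hP gs.
Qed.

End Free.

Section Projective.
Variable R : pzRingType.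
Implicit Types A B C D E F K M N P Q U V W X Y Z : lmodType R.

Lemma free_cover M : exists f : {linear freemod R M -> M}, mod_surjective f.
Proof. by have [f fP] := free_lift (idfun : M -> M); exists f => x; exists (fbas R x); rewrite fP. Qed.

Lemma projective_retract P Q : retract P Q -> projective_mod Q -> projective_mod P.
Proof.
move=> [s [r sr]] pQ M N g f gs; have [h hP] := pQ _ _ g (f \o r) gs.
by exists (h \o s) => x /=; rewrite hP /= sr.
Qed.

Lemma projective_free P : projective_mod P -> retract P (freemod R P).
Proof.
move=> pP; have [f fs] := free_cover P; have [h hP] := pP _ _ f idfun fs.
by exists h, f.
Qed.

Lemma projective_dsum (I : eqType) (P : I -> lmodType R) :
  (forall i, projective_mod (P i)) -> projective_mod (dsum P).
Proof.
move=> pP M N g f gs.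
have /dep_choice[h hP] i : exists h : {linear P i -> M}, forall x, g (h x) = f (dinj P i x).
  by have [h hP] := pP i _ _ g (f \o dinj P i : {linear _ -> _}) gs; exists h.
have [H HP] := dsum_lift h; exists H; apply: (dsum_hom_ext (f := g \o H)) => i y /=.
by rewrite HP hP.
Qed.

Lemma projective_prod P Q : projective_mod P -> projective_mod Q ->
  projective_mod (P * Q)%type.
Proof.
move=> pP pQ M N g f gs.
have [h1 h1P] := pP _ _ g (f \o lin_pair idfun \0 : {linear _ -> _}) gs.
have [h2 h2P] := pQ _ _ g (f \o lin_pair \0 idfun : {linear _ -> _}) gs.
exists (lin_copair h1 h2) => -[x y] /=.
by rewrite linearD h1P h2P /= -linearD -[X in f X]/(x + 0, 0 + y) addr0 add0r.
Qed.

Lemma projective_zero Z : is0 Z -> projective_mod Z.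
Proof. by move=> Z0 M N g f _; exists \0 => x; rewrite (Z0 x) !linear0. Qed.

Lemma ex_zero_mod : exists Z, is0 Z.
Proof. by exists (dsum (fun _ : void => R^o : lmodType R)) => x; apply: dsum_ext => -[]. Qed.

End Projective.

(** * Finite length *)

Lemma ex_min_nat (T : Type) (P : T -> Prop) (f : T -> nat) :
  (exists x, P x) -> exists2 x, P x & forall y, P y -> (f x <= f y)%N.
Proof.
move=> [x Px]; apply: contrapT => nex.
suff H n : forall y, (f y < n)%N -> ~ P y by apply: (H (f x).+1 x).
elim: n => // n IH y yn Py; apply: nex; exists y => // z Pz.
by rewrite leqNgt; apply/negP => zy; apply: (IH z) => //; exact: leq_trans zy yn.
Qed.

Lemma ex_max_nat (T : Type) (P : T -> Prop) (f : T -> nat) b :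
  (exists x, P x) -> (forall x, P x -> (f x <= b)%N) ->
  exists2 x, P x & forall y, P y -> (f y <= f x)%N.
Proof.
move=> ex fb; have [x Px xm] := ex_min_nat (fun x => b - f x)%N ex.
exists x => // y Py; have := xm y Py.
by rewrite leq_sub2lE // fb.
Qed.

(** Used in Zorn arguments for properties of finite character. The first alternative covers the
    empty chain, which has no member to offer. *)
Lemma chain_seq (T : eqType) (F : set (set T)) (s : seq T) :
  total_on F subset -> (forall t, t \in s -> (\bigcup_(E in F) E)%classic t) ->
  s = [::] \/ exists2 E, F E & forall t, t \in s -> E t.
Proof.
move=> Ft; elim: s => [|t s IH] h; [by left | right].
have [E FE Et] := h t (mem_head _ _).
have [|->|[E' FE' E's]] := IH; first by move=> u us; apply: h; rewrite inE us orbT.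
  by exists E => // u; rewrite inE => /eqP->.
have [EE|EE] := Ft E E' FE FE'.
  by exists E' => // u; rewrite inE => /orP[/eqP->|/E's //]; exact: EE.
by exists E => // u; rewrite inE => /orP[/eqP-> //|/E's]; exact: EE.
Qed.

Section FiniteLength.
Variable R : pzRingType.
Implicit Types A B C D E F K M N P Q X Y Z : lmodType R.

Local Open Scope classical_set_scope.

(* Finite length is witnessed by a strictly increasing rank on submodules. *)
Definition finlen M := exists l : set M -> nat, forall U V : set M,
  smod U -> smod V -> U `<=` V -> ~ V `<=` U -> (l U < l V)%N.

Lemma finlen_le M (l : set M -> nat) :
  (forall U V : set M, smod U -> smod V -> U `<=` V -> ~ V `<=` U -> (l U < l V)%N) ->
  forall U V : set M, smod U -> smod V -> U `<=` V -> (l U <= l V)%N.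
Proof.
move=> lP U V HU HV UV; case: (pselect (V `<=` U)) => [VU|/lP lt]; last exact/ltnW/lt.
by have -> : U = V by apply/seteqP.
Qed.

(** The rank is that of the preimage in [X] plus that of the image in [Q]; by the modular law a
    strict inclusion changes at least one of them. *)
Lemma finlen_ext X M Q (f : {linear X -> M}) (g : {linear M -> Q}) :
  mod_exact f g -> finlen X -> finlen Q -> finlen M.
Proof.
move=> ex [l1 l1P] [l2 l2P].
pose p U := [set x | U (f x)]; pose q (U : set M) := (fun y => exists2 x, U x & g x = y) : set Q.
exists (fun U => l1 (p U) + l2 (q U))%N => U V HU HV UV nVU.
have pu := smod_preim f HU; have pv := smod_preim f HV.
have qu := smod_image g HU; have qv := smod_image g HV.
have puv : p U `<=` p V by move=> x /UV.
have quv : q U `<=` q V by move=> y [x /UV]; exists x.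
case: (pselect (p V `<=` p U)) => [pvu|npvu]; last first.
  by rewrite -addSn leq_add // ?l1P // finlen_le.
case: (pselect (q V `<=` q U)) => [qvu|nqvu]; last first.
  by rewrite -addnS leq_add // ?l2P // finlen_le.
case: nVU => x Vx; have [y Uy e] : q U (g x) by apply: qvu; exists x.
have /ex[z fz] : g (x - y) = 0 by rewrite linearB /= e subrr.
have Uz : U (f z) by apply: pvu; rewrite /p /= fz; apply: smodB => //; exact: UV.
by rewrite -(subrK y x) -fz; case: HU => _ UD _; apply: UD.
Qed.

Lemma finlen_inj X M (f : {linear X -> M}) : injective f -> finlen M -> finlen X.
Proof.
move=> fI [l lP]; exists (fun U => l (fun y => exists2 x, U x & f x = y)) => U V HU HV UV nVU.
apply: lP; [exact: smod_image | exact: smod_image | by move=> y [x /UV]; exists x|].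
move=> h; apply: nVU => x Vx; have [|y Uy /fI <- //] := h (f x); by exists x.
Qed.

Lemma finlen_surj M Q (g : {linear M -> Q}) : mod_surjective g -> finlen M -> finlen Q.
Proof.
move=> gs [l lP]; exists (fun U => l (fun x => U (g x))) => U V HU HV UV nVU.
apply: lP; [exact: smod_preim | exact: smod_preim | by move=> x /UV|].
by move=> h; apply: nVU => y; have [x <-] := gs y; apply: h.
Qed.

Lemma finlen0 Z : is0 Z -> finlen Z.
Proof.
move=> Z0; exists (fun=> 0%N) => U V [U0 _ _] _ _ []; by move=> x _; rewrite (Z0 x).
Qed.

Lemma finlen_fin_gen M : finlen (R^o : lmodType R) -> fin_gen M -> finlen M.
Proof.
move=> lR [m [e eP]]; elim: m M e eP => [|m IH] M e eP.
  by apply: finlen0 => x; have [c ->] := eP x; rewrite big_ord0.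
pose f := linscale (e ord0).
have [Q [g [gs gP]]] := ex_quot (smod_range f).
have [K [i [iI iP]]] := ex_sub (smod_range f).
apply: (finlen_ext (f := i) (g := g)).
- by move=> y; rewrite gP iP.
- have [f' f'P] := factor_inj (h := f) iI (fun a => proj1 (iP (f a)) (ex_intro _ a erefl)).
  apply: (finlen_surj (g := f')) lR => y; have [a fa] := proj2 (iP (i y)) (ex_intro _ y erefl).
  by exists a; apply: iI; rewrite f'P fa.
- apply: (IH Q (fun t => g (e (lift ord0 t)))) => y; have [x <-] := gs y.
  have [c ->] := eP x; exists (fun t => c (lift ord0 t)).
  rewrite linear_sum big_ord_recl linearZ /= (_ : g (e ord0) = 0) ?scaler0 ?add0r.
    by apply: eq_bigr => t _; rewrite linearZ.
  by apply/gP; exists 1; rewrite /= scale1r.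
Qed.

Definition sspan M (S : set M) : set M := fun x => forall U, smod U -> S `<=` U -> U x.

Lemma smod_sspan M (S : set M) : smod (sspan S).
Proof.
split=> [U [U0 _ _] //|x y xS yS U HU SU|a x xS U HU SU]; case: (HU) => _ UD UZ.
  by apply: UD; [apply: xS | apply: yS].
by apply: UZ; apply: xS.
Qed.

Lemma sub_sspan M (S : set M) : S `<=` sspan S.
Proof. by move=> x Sx U _; apply. Qed.

Lemma sspan_min M (S U : set M) : smod U -> S `<=` U -> sspan S `<=` U.
Proof. by move=> HU SU x; apply. Qed.

Lemma fin_genP M : fin_gen M <-> exists s : seq M, forall x, sspan [set y | y \in s] x.
Proof.
split=> [[m [e eP]]|[s sP]].
  exists [seq e t | t <- enum 'I_m] => x U [U0 UD UZ] sU; have [c ->] := eP x.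
  elim/big_rec: _ => // t y _ Uy; apply: UD => //; apply: UZ; apply: sU => /=.
  by apply: map_f; rewrite mem_enum.
exists (size s), (fun t => nth 0 s t) => x.
apply: (sP x (fun x => exists c : 'I_(size s) -> R, x = \sum_(t < size s) c t *: nth 0 s t)).
  split=> [|y z [c ->] [d ->]|a y [c ->]].
  - by exists (fun=> 0); rewrite big1 // => t _; rewrite scale0r.
  - exists (fun t => c t + d t); rewrite -big_split; apply: eq_bigr => t _.
    by rewrite scalerDl.
  - exists (fun t => a * c t); rewrite scaler_sumr; apply: eq_bigr => t _.
    by rewrite scalerA.
move=> y /= ys; have yi : (index y s < size s)%N by rewrite index_mem.
exists (fun t => (t == Ordinal yi)%:R).
rewrite (bigD1 (Ordinal yi)) //= eqxx scale1r nth_index // big1 ?addr0 // => t /negPf->.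
by rewrite scale0r.
Qed.

(** A finite set whose span has maximal rank generates: adjoining a further element would raise the
    rank. *)
Lemma finlen_fg M : finlen M -> fin_gen M.
Proof.
move=> [l lP]; apply/fin_genP.
pose T := seq M; pose sp (s : T) := sspan [set y | y \in s].
have [] := @ex_max_nat T (fun=> True) (l \o sp) (l setT).
- by exists [::].
- by move=> s _ /=; apply: finlen_le => //; exact: smod_sspan.
move=> s _ smax; exists s => x; apply: contrapT => nx.
have := smax (x :: s) I; rewrite /= leqNgt => /negP; apply.
apply: lP; [exact: smod_sspan | exact: smod_sspan | |].
  apply: sspan_min; first exact: smod_sspan.
  by move=> y /= ys; apply: sub_sspan => /=; rewrite inE ys orbT.
by move=> h; apply: nx; apply: h; apply: sub_sspan => /=; rewrite inE eqxx.
Qed.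

Lemma fin_gen_surj M N (g : {linear M -> N}) : mod_surjective g -> fin_gen M -> fin_gen N.
Proof.
move=> gs [m [e eP]]; exists m, (g \o e) => y; have [x <-] := gs y.
have [c ->] := eP x; exists c; rewrite linear_sum; apply: eq_bigr => t _.
by rewrite linearZ.
Qed.

Lemma fin_gen_ext X M Q (f : {linear X -> M}) (g : {linear M -> Q}) : mod_exact f g ->
  mod_surjective g -> fin_gen X -> fin_gen Q -> fin_gen M.
Proof.
move=> ex gs /fin_genP[s sP] /fin_genP[t tP]; have [h hP] := choice gs.
apply/fin_genP; exists ([seq f x | x <- s] ++ [seq h y | y <- t]) => x U HU sU.
have fU y : U (f y).
  apply: (sP y _ (smod_preim f HU)) => z /= zs; apply: sU => /=.
  by rewrite mem_cat map_f.
have [z Uz gz] : exists2 z, U z & g z = g x.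
  apply: (tP (g x) _ (smod_image g HU)) => z /= zt; exists (h z) => //.
  by apply: sU => /=; rewrite mem_cat map_f ?orbT.
have /ex[y fy] : g (x - z) = 0 by rewrite linearB /= gz subrr.
by rewrite -(subrK z x) -fy; case: HU => _ UD _; apply: UD.
Qed.

Lemma fin_gen_prod M N : fin_gen M -> fin_gen N -> fin_gen (M * N)%type.
Proof.
apply: (fin_gen_ext (f := lin_pair idfun \0) (g := snd)) => [[x y]|y]; last by exists (0, y).
by split=> [/= ->|[z [] _ <-]//]; exists x.
Qed.

Lemma fin_gen_free m : fin_gen (freemod R 'I_m).
Proof.
exists m, (@fbas R _) => x; exists (fun t => dpr _ t x).
rewrite {1}(@dsum_decomp _ _ _ x (enum 'I_m)) ?enum_uniq // => [|i]; last by rewrite mem_enum.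
by rewrite big_enum /=; apply: eq_bigr => t _; rewrite dinj_fbas.
Qed.

Lemma fin_gen_cover M : fin_gen M -> exists m (f : {linear freemod R 'I_m -> M}), mod_surjective f.
Proof.
move=> [m [e eP]]; have [f fP] := free_lift e; exists m, f => x.
have [c ->] := eP x; exists (\sum_(t < m) c t *: fbas R t).
by rewrite linear_sum; apply: eq_bigr => t _; rewrite linearZ /= fP.
Qed.

Lemma fin_gen0 Z : is0 Z -> fin_gen Z.
Proof.
move=> Z0; exists 0%N, (fun=> 0) => x; exists (fun=> 0); by rewrite big_ord0 (Z0 x).
Qed.

Lemma smod_add M (U V : set M) : smod U -> smod V -> smod (fun x => exists2 u, U u & V (x - u)).
Proof.
move=> [U0 UD UZ] [V0 VD VZ]; split=> [|x y [u Uu Vu] [v Uv Vv]|a x [u Uu Vu]].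
- by exists 0; rewrite ?subr0.
- by exists (u + v); [apply: UD | rewrite opprD addrACA; apply: VD].
- by exists (a *: u); [apply: UZ | rewrite -scalerBr; apply: VZ].
Qed.

Lemma zorn_avoid M (I : set M) w : smod I -> ~ I w ->
  exists H : set M, [/\ smod H, I `<=` H, ~ H w &
    forall H', smod H' -> H `<=` H' -> ~ H' w -> H' `<=` H].
Proof.
move=> HI Iw; pose G H := [/\ smod H, I `<=` H & ~ H w].
have [H [PH Hmax]] : exists A : set M, (A = set0 \/ G A) /\ forall B : set M, A `<` B -> ~ (B = set0 \/ G B).
  apply: Zorn_bigcup => F FP Ft.
  case: (pselect (exists2 H, F H & G H)) => [[H0 FH0 [H0s IH0 H0w]]|nex]; last first.
    left; rewrite predeqE => x; split=> // -[H FH Hx].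
    have [H0|GH] := FP H FH; first by rewrite H0 in Hx.
    by apply: nex; exists H.
  right; have Fs H x : F H -> H x -> smod H.
    by move=> /FP[->//|[]].
  split; last 1 first.
  - by move=> [H FH Hw]; have [H1|[_ _]//] := FP H FH; rewrite H1 in Hw.
  - split=> [|x y [A FA Ax] [B FB By]|a x [A FA Ax]].
    + by exists H0 => //; case: H0s.
    + have [AB|BA] := Ft A B FA FB.
        by exists B => //; have [_ BD _] := Fs B y FB By; apply: BD => //; exact: AB.
      by exists A => //; have [_ AD _] := Fs A x FA Ax; apply: AD => //; exact: BA.
    + by exists A => //; have [_ _ AZ] := Fs A x FA Ax; apply: AZ.
  - by move=> x /IH0; exists H0.
have [H0|[Hs IH Hw]] := PH.
  case: (Hmax I); last by right; split.
  by split; rewrite H0 // => h; case: HI => /h.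
exists H; split=> // H' H's HH' H'w; apply: contrapT => nH.
case: (Hmax H') => //; right; split=> //; exact: subset_trans IH HH'.
Qed.

Lemma artinian_min M (P : set M -> Prop) : artinian_mod M ->
  (exists2 U, smod U & P U) ->
  exists U, [/\ smod U, P U & forall V, smod V -> P V -> V `<=` U -> U `<=` V].
Proof.
move=> art [U0 HU0 PU0]; apply: contrapT => nex.
pose T := {U : set M | smod U /\ P U}.
have /choice[nx nxP] (U : T) : exists V : T, sval V `<=` sval U /\ ~ sval U `<=` sval V.
  case: U => U [HU PU] /=; apply: contrapT => nV; apply: nex.
  exists U; split=> // V HV PV VU; apply: contrapT => nUV; apply: nV.
  by exists (exist _ V (conj HV PV)).
pose sq i := iter i nx (exist _ U0 (conj HU0 PU0)).
have [|m mP] := art (fun i => mksub (proj1 (svalP (sq i)))).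
  by move=> i x /mksubP xi; apply/mksubP; exact: (proj1 (nxP (sq i))).
apply: (proj2 (nxP (sq m))) => x xm.
have := mP m.+1 (leqnSn m) x.
by move=> e; have /mksubP : x \in mksub (proj1 (svalP (sq m.+1))) by rewrite e; apply/mksubP.
Qed.

End FiniteLength.

(** * Commutative artinian rings have finite length *)

Section ArtinianCommutative.
Variable k : comNzRingType.
Local Open Scope classical_set_scope.
Implicit Types U V I J H : set (k^o : lmodType k).

Definition maxid I := [/\ smod I, ~ I 1 &
  forall J, smod J -> I `<=` J -> ~ J 1 -> J `<=` I].

Lemma ex_maxid I : smod I -> ~ I 1 -> exists2 J, maxid J & I `<=` J.
Proof. by move=> HI /(zorn_avoid HI)[J [HJ IJ J1 Jm]]; exists J. Qed.

Lemma maxid_inv I d : maxid I -> ~ I d -> exists e, I (1 - e * d).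
Proof.
move=> [HI I1 Im] Id.
have HJ := smod_add (smod_range (linscale (d : (k^o : lmodType k)))) HI.
apply: contrapT => nex; apply: Id.
have [I0 ID IZ] := HI.
apply: (Im _ HJ).
- by move=> x Ix; exists 0; [exists 0; rewrite /= scale0r | rewrite subr0].
- by move=> [_ [e <-] /= Ie]; apply: nex; exists e.
- by exists d; [exists 1; rewrite /= scale1r | rewrite subrr].
Qed.

(** Finite length of [k / I], expressed through the ideals that contain [I]. *)
Definition relfinlen I := exists l : set (k^o : lmodType k) -> nat, forall U V,
  smod U -> smod V -> I `<=` U -> U `<=` V -> ~ V `<=` U -> (l U < l V)%N.

Definition idmul I J : set (k^o : lmodType k) := sspan (fun x => exists a b, [/\ I a, J b & x = a * b]).

(** If [w] in [I] lies outside [m I], let [H] be maximal among the ideals containing [m I] and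
    avoiding [w]. Then [I] modulo [H] is one-dimensional over [k / m], so [k] modulo the
    intersection of [H] and [I] still has finite length, and minimality puts [I], hence [w], inside
    [H]. *)
Lemma minimal_relfinlen_idmul m I : maxid m -> smod I -> relfinlen I ->
  (forall J, smod J -> relfinlen J -> J `<=` I -> I `<=` J) -> I `<=` idmul m I.
Proof.
move=> mm HI [l lP] Imin w Iw; apply: contrapT => nw.
have [H [HH mIH Hw Hmax]] := zorn_avoid (smod_sspan _ : smod (idmul m I)) nw.
have HI' := smodI HH HI.
suff h : I `<=` (fun x => H x /\ I x) by case: Hw; case: (h w Iw).
apply: Imin => //; last by move=> x [].
have [H0 HD HZ] := HH; have [I0 ID IZ] := HI.
(* One-dimensionality: any [x] of [I] outside [H] spans [I] modulo [H]. Both [x] and [y] have a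
   multiple congruent to [w], and the factor for [y] is invertible modulo [m]. *)
have key x y : I x -> ~ H x -> I y -> exists c, H (y - c * x).
  have getw z : ~ H z -> exists d, H (w - d * z).
    move=> nz; apply: contrapT => nex; apply: nz.
    apply: (Hmax _ (smod_add (smod_range (linscale (z : (k^o : lmodType k)))) HH)).
    - by move=> v Hv; exists 0; [exists 0; rewrite /= scale0r | rewrite subr0].
    - by move=> [_ [d <-] /= Hd]; apply: nex; exists d.
    - by exists z; [exists 1; rewrite /= scale1r | rewrite subrr].
  move=> Ix nx Iy; case: (pselect (H y)) => [Hy|ny]; first by exists 0; rewrite mul0r subr0.
  have [c Hc] := getw x nx; have [d Hd] := getw y ny.
  have nd : ~ m d.
    move=> md; apply: Hw; rewrite -(subrK (d * y) w); apply: HD => //.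
    by apply: mIH; apply: sub_sspan; exists d, y.
  have [e me] := maxid_inv mm nd; exists (e * c).
  have -> : y - e * c * x = (1 - e * d) * y + e *: ((w - c * x) - (w - d * y) : k^o).
    have E (y' e' c' x' d' w' : k) :
      y' - e' * c' * x' = (1 - e' * d') * y' + e' * ((w' - c' * x') - (w' - d' * y')) by ring.
    exact: E.
  apply: HD; first by apply: mIH; apply: sub_sspan; exists (1 - e * d), y.
  by apply: HZ; apply: smodB.
(* For [U] above the intersection of [H] and [I] only two traces on [I] are possible. One bit
   records which, and the rank of [U + I] accounts for the rest. *)
pose b U : nat := if `[< forall x, U x -> I x -> H x >] then 0%N else 1%N.
pose sI U : set (k^o : lmodType k) := fun x => exists2 u, U u & I (x - u).
exists (fun U => l (sI U) + b U)%N => U V HU HV IU UV nVU.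
have sU := smod_add HU HI; have sV := smod_add HV HI.
have IsU W : smod W -> I `<=` sI W by move=> [W0 _ _] x Ix; exists 0; rewrite ?subr0.
have UVs : sI U `<=` sI V by move=> x [u /UV]; exists u.
have bUV : (b U <= b V)%N.
  rewrite /b; case: asboolP => // nU; case: asboolP => // nV; case: nU => x Ux; apply: nV; exact: UV.
case: (pselect (sI V `<=` sI U)) => [sVU|nsVU]; last first.
  by rewrite -addSn; apply: leq_add => //; apply: lP => //; apply: IsU.
have -> : sI U = sI V by apply/seteqP.
rewrite ltn_add2l.
have [U0 UD UZ] := HU; have [V0 VD VZ] := HV.
have [x Vx nUx] : exists2 x, V x & ~ U x.
  by apply: contrapT => nex; apply: nVU => x Vx; apply: contrapT => nx; apply: nex; exists x.
have [u Uu Ixu] : sI U x by apply: sVU; exists x; rewrite ?subrr.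
have Vxu : V (x - u) by apply: smodB => //; apply: UV.
have nUxu : ~ U (x - u) by move=> h; apply: nUx; rewrite -(subrK u x); apply: UD.
rewrite /b; case: asboolP => [_|nU]; last first.
  case: nU => y Uy Iy; apply: contrapT => nHy.
  have [c Hc] := key y (x - u) Iy nHy Ixu.
  apply: nUxu; rewrite -(subrK (c * y) (x - u)); apply: UD; last exact: (UZ c).
  apply: IU; split=> //; apply: smodB => //; exact: (IZ c).
case: asboolP => // hV; case: nUxu; apply: IU; split=> //; exact: hV.
Qed.

(* Take [I] minimal with [k / I] of finite length; then [I = m I] for each maximal
   ideal [m].  If [I] is nonzero, let [U] be minimal with [I U] nonzero: it is
   generated by one element [u], and [U = m U] for [m] containing the annihilator
   of [u], which contradicts Nakayama's lemma. *)
Lemma artinian_comm_finlen : artinian_ring k -> finlen (k^o : lmodType k).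
Proof.
move=> art.
have [|I [HI Ifl Imin]] := artinian_min (P := relfinlen) art.
  exists setT; first by split.
  by exists (fun=> 0%N) => U V _ _ TU _ []; apply: subset_trans TU.
have mI m : maxid m -> I `<=` idmul m I by move=> mm; apply: minimal_relfinlen_idmul.
case: (pselect (exists2 i, I i & i != 0)) => [[i1 Ii1 i1n]|nI]; last first.
  have [l lP] := Ifl; exists l => U V HU HV; apply: lP => // x Ix.
  have [->|x0] := eqVneq x 0; first by case: HU.
  by case: nI; exists x.
have [|U [HU [i0 [u0 [Ii0 Uu0 iu0]]] Umin]] :=
    artinian_min (P := fun U => exists i u, [/\ I i, U u & i * u != 0]) art.
  by exists setT; [split | exists i1, 1; rewrite mulr1].
pose f := linscale (u0 : (k^o : lmodType k)).
have [|m mm am] := ex_maxid (smod_ker f).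
  by rewrite /f /= scale1r => u00; case/eqP: iu0; rewrite u00 mulr0.
have [Hm m1 _] := mm.
have [a ma au] : exists2 a, m a & a * u0 = u0.
  apply: (Umin _ (smod_image f Hm)) => //; last first.
    by move=> _ [a _ <-] /=; case: HU => _ _ UZ; apply: UZ.
  apply: contrapT => nex.
  suff /(_ i0 Ii0) : I `<=` (fun i => i * u0 = 0) by move=> e; case/eqP: iu0.
  apply: (subset_trans (mI m mm)); apply: sspan_min.
    have ml : linear (fun a : k^o => (a * u0 : k^o)).
      by move=> a b c; rewrite mulrDl -[a *: b]/(a * b) -mulrA.
    exact: (smod_ker (mklin ml)).
  move=> _ [a [i [ma Ii ->]]]; apply: contrapT => /eqP nz; apply: nex.
  by exists i, (a * u0); split=> //; [exists a | rewrite mulrA [i * a]mulrC].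
case: m1; rewrite -(subrK a 1); case: (Hm) => _ mD _; apply: mD => //.
by apply: am; rewrite /f /= scalerBl scale1r -[a *: _]/(a * u0) au subrr.
Qed.

End ArtinianCommutative.

(** * Finitely generated modules over an Artin algebra *)

Section EndoFinite.
Variable R : pzRingType.
Local Open Scope classical_set_scope.

Definition endosub (Y : lmodType R) (U : set Y) : Prop :=
  [/\ U 0, forall x y, U x -> U y -> U (x + y) &
      forall (f : {linear Y -> Y}) x, U x -> U (f x)].

(** Finite length over the endomorphism ring. pp-subgroups are stable under endomorphisms, so this
    rank strictly decreases along their descending chains. *)
Definition endofin (Y : lmodType R) := exists l : set Y -> nat, forall U V,
  endosub U -> endosub V -> U `<=` V -> ~ V `<=` U -> (l U < l V)%N.

End EndoFinite.

Section RestrictScalars.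
Variables (k : comNzRingType) (L : algType k) (M : lmodType L).

(** A separate name for the carrier keeps the [k]-module structure apart from the [L]-module
    structure of [M]. *)
Definition kres : Type := M.
HB.instance Definition _ := GRing.Zmodule.on kres.

Definition kres_scale (a : k) (x : kres) : kres := (a%:A : L) *: (x : M).

Fact kres_scaleA a b x : kres_scale a (kres_scale b x) = kres_scale (a * b) x.
Proof. by rewrite /kres_scale scalerA -scalerAl mul1r scalerA. Qed.
Fact kres_scale1 : left_id 1 kres_scale.
Proof. by move=> x; rewrite /kres_scale !scale1r. Qed.
Fact kres_scaleDr : right_distributive kres_scale +%R.
Proof. by move=> a x y; apply: scalerDr. Qed.
Fact kres_scaleDl x : {morph kres_scale^~ x : a b / a + b}.
Proof. by move=> a b; rewrite /kres_scale scalerDl scalerDl. Qed.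

HB.instance Definition _ := GRing.Zmodule_isLmodule.Build k kres
  kres_scaleA kres_scale1 kres_scaleDr kres_scaleDl.

End RestrictScalars.

Section ArtinAlgebra.
Variables (k : comNzRingType) (L : algType k).
Hypothesis artinL : artin_algebra L.
Local Open Scope classical_set_scope.

Lemma kres_fin_gen (M : lmodType L) : fin_gen M -> fin_gen (kres M : lmodType k).
Proof.
move=> [m [e eP]]; have [_ [p [a aP]]] := artinL.
apply/fin_genP; exists [seq (a j *: e i : kres M) | i <- enum 'I_m, j <- enum 'I_p].
move=> x U HU sU; have [c ->] := eP x; have [U0 UD UZ] := HU.
apply: (smod_sum _ HU) => i; have [d ->] := aP (c i); rewrite scaler_suml.
apply: (smod_sum _ HU) => j.
have -> : (d j *: a j) *: e i = d j *: (a j *: e i : kres M).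
  by rewrite -[RHS]/((d j)%:A *: (a j *: e i)) scalerA mulr_algl.
by apply/UZ/sU/allpairsP; exists (i, j); rewrite !mem_enum.
Qed.

(** A single rank on [k]-submodules serves both [artin_finlen] and [artin_endofin]: scalars of [k]
    lie in [L], and being central they also act by [L]-linear endomorphisms. *)
Lemma artin_rank (M : lmodType L) : fin_gen M -> exists l : set M -> nat, forall U V : set M,
  smod (U : set (kres M : lmodType k)) -> smod (V : set (kres M : lmodType k)) ->
  U `<=` V -> ~ V `<=` U -> (l U < l V)%N.
Proof.
by move=> /kres_fin_gen; apply: finlen_fin_gen; apply: artinian_comm_finlen; case: artinL.
Qed.

Lemma artin_finlen (M : lmodType L) : fin_gen M -> finlen M.
Proof.
move=> /artin_rank[l lP]; exists l => U V HU HV; apply: lP.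
  by case: HU => U0 UD UZ; split=> // a x; apply: UZ.
by case: HV => V0 VD VZ; split=> // a x; apply: VZ.
Qed.

Lemma artin_endofin (M : lmodType L) : fin_gen M -> endofin M.
Proof.
move=> /artin_rank[l lP]; exists l.
suff ek (U : set M) : endosub U -> smod (U : set (kres M : lmodType k)) by move=> U V HU HV; exact: (lP U V (ek U HU) (ek V HV)).
case=> U0 UD Uf; split=> // a x Ux.
have sl : linear (fun y : M => (a%:A : L) *: y).
  by move=> b y z; rewrite scalerDr !scalerA -scalerAr -scalerAl mulr1 mul1r.
exact: (Uf (mklin sl) x Ux).
Qed.

End ArtinAlgebra.

(** * Projective dimension and Ext *)

Section ProjectiveDimension.
Variable R : pzRingType.
Implicit Types A B C D E F K M N P Q U V W X Y Z : lmodType R.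

Lemma retract_refl X : retract X X.
Proof. by exists idfun, idfun. Qed.

Lemma section_retract X Y Z (f : {linear X -> Y}) (g : {linear Y -> Z}) (s : {linear Z -> Y}) :
  ses f g -> cancel s g -> retract Y (X * Z)%type.
Proof.
move=> [fI ex gs] sg.
have [|h hP] := factor_inj (h := idfun \- (s \o g)) fI.
  by move=> y; apply/ex; rewrite linearB /= sg subrr.
by exists (lin_pair h g), (lin_copair f s) => y; rewrite /= hP /= subrK.
Qed.

(** Projective dimension at most [n], by iterated kernels: this form suits induction better than a
    whole resolution, to which [finite_pdP] relates it. *)
Fixpoint pdle n X : Prop := if n is n'.+1 then
    exists P K (i : {linear K -> P}) (g : {linear P -> X}),
      [/\ projective_mod P, ses i g & pdle n' K]
  else projective_mod X.

Definition lin_prod A B C D (f : {linear A -> C}) (g : {linear B -> D}) :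
  {linear (A * B)%type -> (C * D)%type} := lin_pair (f \o fst) (g \o snd).

Lemma pdle_add_proj n X Q : pdle n X -> projective_mod Q -> pdle n (X * Q)%type.
Proof.
case: n => [|n] /=; first exact: projective_prod.
move=> [P [K [i [g [pP [iI ex gs] pK]]]]] pQ.
exists (P * Q)%type, K, (lin_pair i \0), (lin_prod g idfun); split=> //; first exact: projective_prod.
split.
- by apply: inj_of_ker => x [] ix; apply: iI; rewrite ix linear0.
- move=> [x y] /=; split=> [[] /ex[z <-] ->|[z [] <- <-]]; first by exists z.
  by congr (_, _); apply/ex; exists z.
- by move=> [x y]; have [z gz] := gs x; exists (z, y); rewrite -gz.
Qed.

(* Schanuel's lemma, in the form needed for retracts. *)
Lemma retract_kernel X M K P (KX : lmodType R) F (i : {linear K -> P}) (g : {linear P -> M})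
    (j : {linear KX -> F}) (e : {linear F -> X}) :
  retract X M -> projective_mod P -> projective_mod F -> ses i g -> ses j e ->
  retract KX (K * F)%type.
Proof.
move=> [s [r sr]] pP pF [iI ex gs] [jI ex' es].
have [a aP] := pF _ _ g (s \o e) gs.
have [b bP] := pP _ _ e (r \o g) es.
have [|aK aKP] := factor_inj (h := a \o j) iI.
  by move=> x; apply/ex; rewrite /= aP /= (proj2 (ex' _) (ex_intro _ x erefl)) linear0.
have [|bK bKP] := factor_inj (h := b \o i) jI.
  by move=> x; apply/ex'; rewrite /= bP /= (proj2 (ex _) (ex_intro _ x erefl)) linear0.
(* [b \o a] lifts the identity of [X], so its difference from the identity of [F] takes values in
   the kernel [KX]; [d] repairs the failure of [bK] to invert [aK]. *)
have [|d dP] := factor_inj (h := idfun \- (b \o a)) jI.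
  by move=> x; apply/ex'; rewrite linearB /= bP /= aP /= sr subrr.
exists (lin_pair aK j), (lin_copair bK d) => x; apply: jI.
by rewrite linearD /= bKP /= aKP dP /= addrC subrK.
Qed.

Lemma pdle_retract n X M : retract X M -> pdle n M -> pdle n X.
Proof.
elim: n X M => [|n IH] X M rXM /=; first exact: projective_retract.
move=> [P [K [i [g [pP sg pK]]]]].
have [e es] := free_cover X; have [KX [j se]] := ses_ker es.
exists (freemod R X), KX, j, e; split=> //; first exact: free_projective.
apply: IH (retract_kernel rXM pP (@free_projective _ _) sg se) _.
exact/pdle_add_proj/free_projective.
Qed.

(** By Schanuel's lemma the kernel of any surjection from a projective module may be used, not just
    of the one that [pdle] supplies. *)
Lemma pdle_kernel n X P K (i : {linear K -> P}) (g : {linear P -> X}) :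
  projective_mod P -> ses i g -> pdle n.+1 X -> pdle n K.
Proof.
move=> pP sg [P' [K' [i' [g' [pP' sg' pK']]]]].
apply: pdle_retract (retract_kernel (retract_refl X) pP' pP sg' sg) _.
exact: pdle_add_proj.
Qed.

(** Horseshoe lemma: the product of [P1] and [P2] maps onto [B], and the three kernels again form a
    short exact sequence. *)
Lemma pdle_ext n A B C (f : {linear A -> B}) (g : {linear B -> C}) :
  ses f g -> pdle n A -> pdle n C -> pdle n B.
Proof.
elim: n A B C f g => [|n IH] A B C f g s /=.
  move=> pA pC; have [_ _ gs] := s; have [h hP] := pC _ _ g idfun gs.
  by apply: projective_retract (section_retract s hP) _; apply: projective_prod.
move=> [P1 [K1 [i1 [g1 [pP1 s1 pK1]]]]] [P2 [K2 [i2 [g2 [pP2 s2 pK2]]]]].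
have [fI ex gs] := s; have [h hP] := pP2 _ _ g g2 gs.
have [i1I ex1 g1s] := s1; have [i2I ex2 g2s] := s2.
pose q := lin_copair (f \o g1) h.
have qs : mod_surjective q.
  move=> b; have [y gy] := g2s (g b).
  have /ex[a fa] : g (b - h y) = 0 by rewrite linearB /= hP gy subrr.
  by have [x gx] := g1s a; exists (x, y); rewrite /= gx fa subrK.
have [K [j sj]] := ses_ker qs; have [jI exj _] := sj.
exists (P1 * P2)%type, K, j, q; split=> //; first exact: projective_prod.
have [u uP] : exists u : {linear K1 -> K}, forall x, j (u x) = lin_pair i1 \0 x.
  apply: factor_inj => // x; apply/exj.
  by rewrite /= (ses_zero s1) !linear0 addr0.
have [v vP] : exists v : {linear K -> K2}, forall x, i2 (v x) = (j x).2.
  apply: (factor_inj (h := snd \o j)) => // x; apply/ex2 => /=.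
  have := ses_zero sj x; rewrite /q /= => /(congr1 g); rewrite linearD /= (ses_zero s) add0r hP.
  by move=> ->; rewrite linear0.
apply: (IH K1 K K2 u v) => //; split.
- by apply: inj_of_ker => x ux; have := uP x; rewrite ux linear0 /= => -[] /esym ix; apply: i1I; rewrite ix linear0.
- move=> x; split=> [vx|[y <-]]; last by apply: i2I; rewrite vP uP /= linear0.
  have jx2 : (j x).2 = 0 by rewrite -vP vx linear0.
  have := ses_zero sj x; rewrite /q /= jx2 linear0 addr0 => fg.
  have /ex1[y iy] : g1 (j x).1 = 0 by apply: fI; rewrite fg linear0.
  by exists y; apply: jI; rewrite uP /= iy; case: (j x) jx2 => /= ? ? ->.
- move=> y.
  have /ex[a fa] : g (h (i2 y)) = 0 by rewrite hP (ses_zero s2).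
  have [x gx] := g1s a.
  have /exj[z jz] : q (- x, i2 y) = 0 by rewrite /q /= !linearN /= gx fa addNr.
  by exists z; apply: i2I; rewrite vP jz.
Qed.

Lemma pdleS n X : pdle n X -> pdle n.+1 X.
Proof.
elim: n X => [|n IH] X pX; last first.
  have [P [K [i [g [pP sg pK]]]]] := pX.
  by exists P, K, i, g; split=> //; apply: IH.
have [Z Z0] := ex_zero_mod R; exists X, Z, \0, idfun; split=> //; first exact: ses_id.
exact: projective_zero.
Qed.

Lemma pdle_leq m n X : (m <= n)%N -> pdle m X -> pdle n X.
Proof. by move=> /subnK<-; elim: (n - m)%N => // d IH /IH; apply: pdleS. Qed.

Lemma pdle0 n Z : is0 Z -> pdle n Z.
Proof. by move=> Z0; apply: (pdle_leq (m := 0)) => //; apply: projective_zero. Qed.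

(** For [P] projective over [B], the kernel of the composite onto [C] is an extension of [A] by the
    kernel of [P -> B]. *)
Lemma pdle_coker n A B C (f : {linear A -> B}) (g : {linear B -> C}) :
  ses f g -> pdle n A -> pdle n.+1 B -> pdle n.+1 C.
Proof.
move=> [fI ex gs] pA [P [K [i [e [pP [iI ex' es] pK]]]]].
have cs : mod_surjective (g \o e).
  by move=> c; have [b <-] := gs c; have [p <-] := es b; exists p.
have [K' [i' [i'I ex'' _]]] := ses_ker cs.
exists P, K', i', (g \o e); split=> //.
have [u uP] : exists u : {linear K -> K'}, forall x, i' (u x) = i x.
  by apply: factor_inj => // x; apply/ex''; rewrite /= (proj2 (ex' _) (ex_intro _ x erefl)) linear0.
have [v vP] : exists v : {linear K' -> A}, forall x, f (v x) = e (i' x).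
  by apply: (factor_inj (h := e \o i')) => // x; apply/ex; apply: (proj2 (ex'' _)); exists x.
apply: (pdle_ext (f := u) (g := v)) => //; split.
- by move=> x y xy; apply: iI; rewrite -!uP xy.
- move=> x; split=> [vx|[y <-]].
    have /ex'[y iy] : e (i' x) = 0 by rewrite -vP vx linear0.
    by exists y; apply: i'I; rewrite uP.
  by apply: fI; rewrite vP uP linear0; apply/ex'; exists y.
- move=> a; have [p ep] := es (f a).
  have /ex''[x ix] : (g \o e) p = 0 by rewrite /= ep; apply/ex; exists a.
  by exists x; apply: fI; rewrite vP ix.
Qed.

Lemma pdle_dsum n (I : eqType) (M : I -> lmodType R) :
  (forall i, pdle n (M i)) -> pdle n (dsum M).
Proof.
elim: n M => [|n IH] M /= pM; first exact: projective_dsum.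
have [P PP] := dep_choice pM; have [K KP] := dep_choice PP.
have [j jP] := dep_choice KP; have [g gP] := dep_choice jP.
have [|J [G [sJG _ _]]] := dsum_ses (f := j) (g := g); first by move=> i; case: (gP i).
exists (dsum P), (dsum K), J, G; split=> //.
  by apply: projective_dsum => i; case: (gP i).
by apply: IH => i; case: (gP i).
Qed.

Lemma pdle_resolution n X : has_proj_resolution X n -> pdle n X.
Proof.
elim: n X => [|n IH] X [P [d [e [pP P0 es ex exs]]]] /=.
  have eI : injective e.
    apply: inj_of_ker => x /ex[y <-]; by rewrite (P0 1%N _ y) ?linear0.
  have /bij_lin_inv[g [eg ge]] := inj_surj_bij eI es.
  by apply: projective_retract (pP 0%N); exists g, e.
have [K [i [iI exi _]]] := ses_ker es.
exists (P 0%N), K, i, e; split=> //; apply: IH.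
have [e' e'P] : exists e' : {linear P 1%N -> K}, forall x, i (e' x) = d 0%N x.
  by apply: factor_inj => // x; apply/exi/ex; exists x.
exists (fun i => P i.+1), (fun i => d i.+1), e'; split=> //.
- by move=> m nm; apply: P0.
- move=> y; have /ex[x dx] : e (i y) = 0 by apply/exi; exists y.
  by exists x; apply: iI; rewrite e'P.
- move=> y; rewrite -(exs 0%N y) -e'P; split=> [->|]; first exact: linear0.
  by move=> h; apply: iI; rewrite h linear0.
Qed.

Lemma resolution_pdle n X : pdle n X -> has_proj_resolution X n.
Proof.
elim: n X => [|n IH] X /= pX.
  have [Z Z0] := ex_zero_mod R.
  pose P m := if m is 0%N then X else Z.
  exists P, (fun m => \0), idfun; split.
  - by case=> // m; apply: projective_zero.
  - by case=> // m _ x; apply: Z0.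
  - by move=> x; exists x.
  - by move=> x; split=> [/= ->|[y <-]//]; exists 0.
  - by move=> m x; split=> // _; exists 0; rewrite linear0; symmetry; apply: Z0.
have [P [K [i [g [pP [iI ex gs] pK]]]]] := pX.
have [Q [d [e [pQ Q0 es exe exd]]]] := IH K pK.
pose T m := if m is m'.+1 then Q m' else P.
pose D m : {linear T m.+1 -> T m} := match m with 0 => i \o e | m'.+1 => d m' end.
exists T, D, g; split=> //.
- by case.
- by case=> // m nm; apply: Q0.
- move=> y; rewrite (ex y); split=> [[x <-]|[x <-]]; last by exists (e x).
  by have [z <-] := es x; exists z.
- case=> // x /=; rewrite -(exe x); split=> [ix|-> //]; last exact: linear0.
  by apply: iI; rewrite ix linear0.
Qed.

Lemma finite_pdP X : finite_proj_dim X <-> exists n, pdle n X.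
Proof. by split=> -[n h]; exists n; [apply: pdle_resolution | apply: resolution_pdle]. Qed.

(* [Ext^1(X, Y) = 0], as a lifting property. *)
Definition ext10 X Y : Prop := forall E D (i : {linear Y -> E}) (g : {linear E -> D}),
  ses i g -> forall h : {linear X -> D}, exists h' : {linear X -> E}, forall x, g (h' x) = h x.

(** The lift is made in two stages, through [E / Y1]: this is an extension of [D] by [Y2], and [E]
    is an extension of it by [Y1]. *)
Lemma ext10_ext X Y1 Y Y2 (f : {linear Y1 -> Y}) (g : {linear Y -> Y2}) :
  ses f g -> ext10 X Y1 -> ext10 X Y2 -> ext10 X Y.
Proof.
move=> s e1 e2 E D i p [iI ex ps] h; have [fI exf gs] := s.
have ifI : injective (i \o f) by move=> x y /iI/fI.
have [Q [q sq]] := ses_coker ifI; have [_ exq qs] := sq.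
have [j jP] : exists j : {linear Y2 -> Q}, forall y, j (g y) = q (i y).
  apply: (factor_surj (h := q \o i)) => // y /exf[z <-]; apply/exq; by exists z.
have [r rP] : exists r : {linear Q -> D}, forall x, r (q x) = p x.
  by apply: factor_surj => // x /exq[z <-]; apply/ex; exists (f z).
have sr : ses j r.
  split.
  - apply: inj_of_ker => y2; have [y <-] := gs y2; rewrite jP => /exq[z /iI <-].
    by apply/exf; exists z.
  - move=> x; have [z <-] := qs x; rewrite rP; split=> [/ex[y <-]|[y2]].
      by exists (g y).
    have [y <-] := gs y2; rewrite jP => e.
    have /exq[w ew] : q (z - i y) = 0 by rewrite linearB /= e subrr.
    by apply/ex; exists (f w + y); rewrite linearD /= -[i (f w)]/((i \o f) w) ew subrK.
  - by move=> d; have [x <-] := ps d; exists (q x).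
have [h1 h1P] := e2 _ _ _ _ sr h; have [h2 h2P] := e1 _ _ _ _ sq h1.
by exists h2 => x; rewrite -rP h2P h1P.
Qed.

Lemma ext10_zero X Y : is0 Y -> ext10 X Y.
Proof.
move=> Y0 E D i g [iI ex gs] h; apply: factor_inj => [|x]; last exact: gs.
by apply: inj_of_ker => x /ex[y <-]; rewrite (Y0 y) linear0.
Qed.

Lemma ext10_dsum (I : eqType) (X : I -> lmodType R) Y :
  (forall i, ext10 (X i) Y) -> ext10 (dsum X) Y.
Proof.
move=> eX E D i g s h.
have [h' h'P] := dep_choice (fun j => eX j _ _ _ _ s (h \o dinj X j)).
have [H HP] := dsum_lift h'; exists H; apply: (dsum_hom_ext (f := g \o H)) => j y /=.
by rewrite HP h'P.
Qed.

(** The pushout along [u] is an extension of [X] by [Y]; a splitting retracts it onto [Y], and the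
    retraction restricted to [Q] extends [u]. *)
Lemma ext10_extend X Y U Q (i : {linear U -> Q}) (g : {linear Q -> X}) (u : {linear U -> Y}) :
  ses i g -> ext10 X Y -> exists v : {linear Q -> Y}, forall x, v (i x) = u x.
Proof.
move=> s eX; have [P [p [j [q [sj pij qp _ _]]]]] := pushout_ses u s.
have [t tP] := eX _ _ _ _ sj idfun; have [jI exj _] := sj.
have [v vP] : exists v : {linear Q -> Y}, forall x, j (v x) = (p \- (t \o g)) x.
  by apply: factor_inj => // x; apply/exj; rewrite linearB /= qp tP subrr.
exists v => x; apply: jI; rewrite vP /= (ses_zero s) linear0 subr0; exact: pij.
Qed.

(** One presentation by a projective module suffices: lift [h \o g] to [Q], then subtract an
    extension of the map that the lift induces from [U] to [Y]. *)
Lemma ext10_of_extend X Y U Q (i : {linear U -> Q}) (g : {linear Q -> X}) :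
  projective_mod Q -> ses i g ->
  (forall u : {linear U -> Y}, exists v : {linear Q -> Y}, forall x, v (i x) = u x) -> ext10 X Y.
Proof.
move=> pQ s ev E D j p [jI ex ps] h; have [l lP] := pQ _ _ p (h \o g) ps.
have [|u uP] := factor_inj (h := l \o i) jI.
  by move=> x; apply/ex; rewrite /= lP /= (ses_zero s) linear0.
have [v vP] := ev u; have [_ exi gs] := s.
have [t tP] : exists t : {linear X -> E}, forall x, t (g x) = (l \- (j \o v)) x.
  by apply: factor_surj => // x /exi[y <-]; rewrite /= vP uP subrr.
exists t => x; have [z <-] := gs x.
by rewrite tP linearB /= lP /= (proj2 (ex _) (ex_intro _ _ erefl)) subr0.
Qed.

End ProjectiveDimension.

(** * Minimal approximations *)

Section Length.
Variable R : pzRingType.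
Implicit Types A B C D E F K M N P Q X Y Z : lmodType R.
Local Open Scope classical_set_scope.

Lemma simple_modP M : simple_mod M <-> (exists x : M, x != 0) /\
  forall U : set M, smod U -> (forall x, U x -> x = 0) \/ (forall x, U x).
Proof.
split=> -[ne h]; split=> // U.
  move=> HU; have [U0|UT] := h (mksub HU); [left|right] => x.
    by move=> Ux; apply/eqP; rewrite -[_ == _]/(x \in pred1 0) -U0; apply/mksubP.
  by have /mksubP : x \in mksub HU by rewrite UT.
have [U0|UT] := h _ (submod_smod U); [left|right] => x; last by rewrite UT.
by apply/idP/eqP => [/U0|->] //; exact: (rpred0 U).
Qed.

Lemma factmod_pi M (U V : submodClosed M) : exists g : {linear submod_of U -> factmod U V},
  mod_surjective g /\ forall x, g x = 0 <-> val x \in V.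
Proof.
exists \pi_(quotmod (submod_in U V)); split=> [y|x]; first by exists (repr y); exact: (reprK y).
by rewrite pi_quotmod0.
Qed.

(** Equality of [U] and [V] is allowed, because the image of a composition series under a quotient
    map may repeat a term. *)
Definition wgap M (U V : set M) : Prop := V `<=` U /\
  forall W, smod W -> V `<=` W -> W `<=` U -> W `<=` V \/ U `<=` W.

Lemma simple_factP M (U V : submodClosed M) : {subset V <= U} ->
  simple_mod (factmod U V) <->
  wgap (fun x => x \in U) (fun x => x \in V) /\ ~ {subset U <= V}.
Proof.
move=> VU; have [g [gs gP]] := factmod_pi U V.
split=> [/simple_modP[[y yn] h]|[[_ h] nUV]].
  split; last first.
    move=> UV; have [x gx] := gs y; case/eqP: yn; rewrite -gx; apply/gP.
    exact/UV/(valP x).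
  split=> // W HW VW WU.
  have HW' := smod_image g (smod_preim (val : {linear submod_of U -> M}) HW).
  have [W0|WT] := h _ HW'; [left|right] => x.
    move=> Wx; apply: (proj1 (gP (Submod (WU x Wx)))); apply: W0.
    by exists (Submod (WU x Wx)).
  move=> Ux; have [z Wz gz] := WT (g (Submod Ux)).
  have /gP /= Vzx : g (Submod Ux - z) = 0 by rewrite linearB /= gz subrr.
  have [_ WD _] := HW; have := WD _ _ (VW _ Vzx) Wz; by rewrite /= subrK.
apply/simple_modP; split.
  apply: contrapT => nex; apply: nUV => x Ux; apply/(gP (Submod Ux)).
  by apply: contrapT => /eqP nz; apply: nex; exists (g (Submod Ux)).
move=> W HW.
pose W' : set M := fun x => exists2 u : submod_of U, W (g u) & val u = x.
have HW' : smod W' by apply: (smod_image (val : {linear submod_of U -> M})); exact: smod_preim.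
have [||WV|UW] := h _ HW'.
- move=> x Vx; exists (Submod (VU x Vx)) => //.
  by rewrite (proj2 (gP (Submod (VU x Vx))) Vx); case: HW.
- by move=> _ [u _ <-]; exact: (valP u).
- left=> y Wy; have [u gu] := gs y; rewrite -gu; apply/gP.
  by apply: WV; exists u; rewrite ?gu.
- right=> y; have [u <-] := gs y; have [v Wv e] := UW _ (valP u).
  by rewrite -(val_inj e : v = u).
Qed.

Definition wchain X (U : nat -> set X) l : Prop :=
  [/\ forall i, smod (U i), forall x, U 0%N x, forall x, U l x -> x = 0 &
      forall i, (i < l)%N -> wgap (U i) (U i.+1)].

Lemma has_lengthP X l : has_length X l <-> exists2 U : nat -> set X, wchain U l &
  forall i, (i < l)%N -> ~ U i `<=` U i.+1.
Proof.
split=> [[U [U0 Ul Ud Us]]|[U [HU U0 Ul Ug] Un]].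
  exists (fun i x => x \in U i).
    split=> [i|x|x|i il]; first exact: submod_smod.
    - by rewrite U0.
    - by rewrite Ul => /eqP.
    - by have /simple_factP[] := Us i il; first exact: Ud.
  by move=> i il; have /simple_factP[] := Us i il; first exact: Ud.
exists (fun i => mksub (HU i)); split=> [x|x|i il x|i il].
- exact/mksubP.
- apply/idP/eqP => [/mksubP/Ul //|->]; apply/mksubP; by case: (HU l).
- by move=> /mksubP xU; apply/mksubP; case: (Ug i il) => UU _; apply: UU.
- have e j : ((fun x => x \in mksub (HU j)) : set X) = U j.
    by apply/seteqP; split=> x /mksubP.
  apply/simple_factP; first by move=> x /mksubP xU; apply/mksubP; case: (Ug i il) => UU _; apply: UU.
  rewrite !e; split; first exact: Ug.
  by move=> h; apply: (Un i il) => x xU; apply/mksubP/h/mksubP.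
Qed.

Lemma wchain_del X (U : nat -> set X) l i : wchain U l.+1 -> (i <= l)%N -> U i `<=` U i.+1 ->
  exists V : nat -> set X, wchain V l.
Proof.
move=> [HU U0 Ul Ug] il UU; exists (fun t => if (t <= i)%N then U t else U t.+1).
have e : U i = U i.+1 by apply/seteqP; split=> //; case: (Ug i il).
split=> [t|x|x|t tl]; first by case: ifP.
- by rewrite leq0n.
- case: ifPn => [li|_]; last exact: Ul.
  have ei : l = i by apply/eqP; rewrite eqn_leq li il.
  by rewrite ei e -ei; apply: Ul.
- case: (ltngtP t i) => ti.
  + by apply: Ug; rewrite ltnS ltnW.
  + by apply: Ug.
  + by rewrite ti e; apply: Ug; rewrite -ti ltnS.
Qed.

Lemma wchain_length X (U : nat -> set X) l : wchain U l -> exists2 m, (m <= l)%N & has_length X m.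
Proof.
elim: l U => [|l IH] U cU.
  by exists 0%N => //; apply/has_lengthP; exists U.
case: (pselect (exists2 i, (i <= l)%N & U i `<=` U i.+1)) => [[i il UU]|nex].
  have [V /IH[m ml mX]] := wchain_del cU il UU.
  by exists m => //; apply: leqW.
exists l.+1 => //; apply/has_lengthP; exists U => // i il UU; apply: nex.
by exists i.
Qed.

(** This avoids the Jordan-Hoelder theorem. Let [x] in the kernel drop out of the series between
    [U i] and [U i.+1]; then [U i] is [U i.+1] plus the multiples of [x], so the image series
    repeats a term, which is deleted. *)
Lemma length_quotient A B (q : {linear A -> B}) l : mod_surjective q -> has_length A l ->
  (exists2 x, q x = 0 & x != 0) -> exists2 m, (m < l)%N & has_length B m.
Proof.
move=> qs /has_lengthP[U [HU U0 Ul Ug] _] [x qx xn].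
pose V i : set B := fun y => exists2 x, U i x & q x = y.
have cV : wchain V l.
  split=> [i|y|_ [z /Ul -> <-]|i il]; [exact: smod_image| |by rewrite linear0|].
    by have [z <-] := qs y; exists z.
  have [UU Ui] := Ug i il; split=> [_ [z /UU Uz <-]|W HW VW WV]; first by exists z.
  have [||h|h] := Ui _ (smodI (smod_preim q HW) (HU i)).
  - by move=> z Uz; split; [apply: VW; exists z | apply: UU].
  - by move=> z [].
  - by left=> w Ww; have [z Uz qz] := WV w Ww; exists z => //; apply: h; rewrite qz.
  - by right=> _ [z Uz <-]; case: (h z Uz).
have [i il [Uix nUix]] : exists2 i, (i < l)%N & U i x /\ ~ U i.+1 x.
  apply: contrapT => nex; case/eqP: xn; apply: Ul.
  suff H j : (j <= l)%N -> U j x by apply: H.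
  elim: j => // j IH jl; apply: contrapT => nU; apply: nex; exists j => //; split=> //.
  by apply: IH; apply: ltnW.
case: l il Ul Ug cV => // l il Ul Ug cV.
have VV : V i `<=` V i.+1.
  have [_ Ui] := Ug i il; have [_ UD _] := HU i; have [_ _ UZ] := HU i.
  have HW := smod_add (smod_range (linscale x)) (HU i.+1).
  have [|||h] := Ui _ HW.
  - by move=> z Uz; exists 0; [exists 0; rewrite /= scale0r | rewrite subr0].
  - move=> z [_ [c <-] /= Uz]; rewrite -(subrK (c *: x) z); apply: UD; last exact: UZ.
    by case: (Ug i il) => UU _; apply: UU.
  - by move=> h; case: nUix; apply: h; exists x; [exists 1; rewrite /= scale1r | rewrite subrr; case: (HU i.+1)].
  - move=> _ [z Uz <-]; have [_ [c <-] /= Uzc] := h z Uz; exists (z - c *: x) => //.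
    by rewrite linearB linearZ /= qx scaler0 subr0.
have [W /wchain_length[m ml mB]] := wchain_del cV il VV.
by exists m.
Qed.

End Length.

(** * Closure properties of [Pinfmod] and Wakamatsu's lemma *)

Section FinitelyGeneratedFiniteDimension.
Variable R : pzRingType.
Hypothesis finR : finlen (R^o : lmodType R).
Implicit Types A B C D E F K M N P Q S X Y Z : lmodType R.

Lemma fin_gen_sub X M (f : {linear X -> M}) : injective f -> fin_gen M -> fin_gen X.
Proof. by move=> fI fM; apply: finlen_fg; apply: (finlen_inj fI); exact: finlen_fin_gen. Qed.

Lemma retract_surj X M : retract X M -> exists r : {linear M -> X}, mod_surjective r.
Proof. by move=> [s [r sr]]; exists r => x; exists (s x). Qed.

Lemma Pinf_retract X M : retract X M -> Pinfmod M -> Pinfmod X.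
Proof.
move=> rXM [fM /finite_pdP[n pM]]; split; last by apply/finite_pdP; exists n; exact: pdle_retract rXM pM.
by have [r rs] := retract_surj rXM; exact: (fin_gen_surj rs).
Qed.

Lemma Pinf_ext A B C (f : {linear A -> B}) (g : {linear B -> C}) :
  ses f g -> Pinfmod A -> Pinfmod C -> Pinfmod B.
Proof.
move=> s [fA /finite_pdP[n pA]] [fC /finite_pdP[m pC]]; split.
  by have [_ ex gs] := s; exact: fin_gen_ext ex gs fA fC.
apply/finite_pdP; exists (maxn n m); apply: (pdle_ext s).
  by apply: pdle_leq pA; exact: leq_maxl.
by apply: pdle_leq pC; exact: leq_maxr.
Qed.

Lemma Pinf_coker A B C (f : {linear A -> B}) (g : {linear B -> C}) :
  ses f g -> Pinfmod A -> Pinfmod B -> Pinfmod C.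
Proof.
move=> s [fA /finite_pdP[n pA]] [fB /finite_pdP[m pB]]; split.
  by have [_ ex gs] := s; exact: fin_gen_surj gs fB.
apply/finite_pdP; exists (maxn n m).+1; apply: (pdle_coker s).
  by apply: pdle_leq pA; exact: leq_maxl.
by apply: pdle_leq pB; apply: leqW; exact: leq_maxr.
Qed.

Lemma Pinf_zero Z : is0 Z -> Pinfmod Z.
Proof. by move=> Z0; split; [exact: fin_gen0 | apply/finite_pdP; exists 0%N; exact: pdle0]. Qed.

Lemma Pinf_free m : Pinfmod (freemod R 'I_m).
Proof. by split; [exact: fin_gen_free | apply/finite_pdP; exists 0%N; exact: free_projective]. Qed.

Lemma Pinf_kernel A P K (i : {linear K -> P}) (g : {linear P -> A}) :
  ses i g -> projective_mod P -> fin_gen P -> Pinfmod A -> Pinfmod K.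
Proof.
move=> s pP fP [_ /finite_pdP[n pA]]; split; first by have [iI _ _] := s; exact: (fin_gen_sub iI fP).
by apply/finite_pdP; exists n; apply: (pdle_kernel pP s); exact: pdleS.
Qed.

Lemma ses_prod M N : ses (lin_pair idfun \0 : {linear M -> (M * N)%type}) (snd : {linear (M * N)%type -> N}).
Proof.
split=> [x y []//|[x y]|y]; last by exists (0, y).
by split=> [/= ->|[z [] _ <-]//]; exists x.
Qed.

Lemma Pinf_prod A B : Pinfmod A -> Pinfmod B -> Pinfmod (A * B)%type.
Proof. exact: Pinf_ext (ses_prod A B). Qed.

Lemma ex_image M N (f : {linear M -> N}) : exists B (q : {linear M -> B}) (i : {linear B -> N}),
  [/\ mod_surjective q, injective i & forall x, i (q x) = f x].
Proof.
have [B [i [iI iP]]] := ex_sub (smod_range f).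
have [q qP] := factor_inj (h := f) iI (fun x => proj1 (iP _) (ex_intro _ x erefl)).
exists B, q, i; split=> // b; have /iP[x fx] : exists b', i b' = i b by exists b.
by exists x; apply: iI; rewrite qP.
Qed.

(* A variant of Fitting's lemma.  Among the endomorphisms [u] of [A] over [S] with
   kernel above that of [phi] and image below that of [phi], choose one with small
   image and large kernel.  Then [u \o u] has the same image and kernel as [u], so
   the image of [u] is a direct summand of [A], and it is an approximation. *)
Lemma minimal_approximation_bij S A (f : {linear A -> S}) l : approximation (@Pinfmod R) f ->
  has_length A l ->
  (forall B m, is_approximation (@Pinfmod R) S B -> has_length B m -> (l <= m)%N) ->
  forall phi : {linear A -> A}, (forall x, f (phi x) = f x) -> bijective phi.
Proof.
move=> [CA apf] lA lmin phi fphi.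
have [rk rkP] : finlen A by apply: finlen_fin_gen => //; case: CA.
pose im (u : {linear A -> A}) : set A := fun y => exists x, u x = y.
pose ke (u : {linear A -> A}) : set A := fun x => u x = 0.
pose T (u : {linear A -> A}) := [/\ forall x, f (u x) = f x, forall x, phi x = 0 -> u x = 0 &
  forall x, im phi (u x)].
have [|u [fu phu uph] umin] := ex_min_nat (P := T) (fun u => rk (im u) + (rk setT - rk (ke u)))%N.
  by exists phi; split=> // x; exists x.
have := umin (u \o u); have Tuu : T (u \o u).
  by split=> x /=; [rewrite !fu | move=> /phu ->; rewrite linear0 | apply: uph].
move=> /(_ Tuu) {Tuu}.
have iuu : (im (u \o u) `<=` im u)%classic by move=> _ [x <-]; exists (u x).
have kuu : (ke u `<=` ke (u \o u))%classic by move=> x ux; rewrite /ke /= ux linear0.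
have HT : smod (setT : set A) by [].
have kT v : (rk (ke v) <= rk setT)%N by apply: finlen_le => //; exact: smod_ker.
have Hi v : smod (im v) := smod_range v.
have Hk v : smod (ke v) := smod_ker v.
have ik : forall a b c d t : nat, (c <= t -> b + (t - d) <= a + (t - c) -> a <= b -> d <= c -> ~~ (a < b) /\ ~~ (d < c))%N.
  by move=> a b c d t; lia.
move=> h.
have [/negP ni /negP nk] := ik _ _ _ _ _ (kT (u \o u)) h (finlen_le rkP (Hi _) (Hi _) iuu) (finlen_le rkP (Hk _) (Hk _) kuu).
have imu : (im u `<=` im (u \o u))%classic.
  by apply: contrapT => nn; apply: ni; exact: rkP.
have keu : (ke (u \o u) `<=` ke u)%classic.
  by apply: contrapT => nn; apply: nk; exact: rkP.
have [B [q [i [qs iI iq]]]] := ex_image u.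
have qib : bijective (q \o i).
  apply: inj_surj_bij => [|b].
    apply: inj_of_ker => b /= qib; have [a qa] := qs b; apply: iI.
    rewrite -qa iq linear0; apply: keu; by rewrite /ke /= -(iq a) qa -iq qib linear0.
  have [a qa] := qs b; have [a' e] : im (u \o u) (u a) by apply: imu; exists a.
  by exists (q a'); apply: iI; rewrite /= !iq -qa iq.
have [v [vqi _]] := bij_lin_inv qib.
have rBA : retract B A by exists i, (v \o q).
(* Otherwise the image [B] of [u] is a proper quotient of [A], hence shorter, and yet it is an
   approximation of [S]. *)
have uI x : u x = 0 -> x = 0.
  move=> ux; apply: contrapT => /eqP xn.
  have [|m ml mB] := length_quotient qs lA.
    by exists x => //; apply: iI; rewrite iq ux linear0.
  suff : (l <= m)%N by rewrite leqNgt ml.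
  apply: lmin mB; exists (f \o i); split; first exact: Pinf_retract CA.
  move=> Z CZ g; have [h' hP] := apf Z CZ g; exists (q \o h') => z.
  by rewrite hP /= iq fu.
apply: inj_surj_bij => [|y]; first by apply: inj_of_ker => x /phu/uI.
have [x e] : im (u \o u) (u y) by apply: imu; exists y.
have [z pz] := uph x; exists z; rewrite pz.
by apply/eqP; rewrite -subr_eq0; apply/eqP/uI; rewrite linearB /= -e subrr.
Qed.

(** Lifting [h] amounts to splitting the pullback of the extension along [h]; [E'] is that
    pullback. *)
Lemma ext10_of_split X Y :
  (forall E (i : {linear Y -> E}) (p : {linear E -> X}), ses i p ->
     exists s : {linear X -> E}, cancel s p) -> ext10 X Y.
Proof.
move=> sp E D i p [iI ex ps] h.
have [E' [j [jI jP]]] := ex_sub (smod_ker (lin_copair p (\- h))).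
have jE x : p (j x).1 = h (j x).2.
  by apply/eqP; rewrite -subr_eq0; apply/eqP; apply/(jP (j x)); exists x.
have [i' i'P] : exists i' : {linear Y -> E'}, forall y, j (i' y) = lin_pair i \0 y.
  apply: factor_inj => // y; apply/jP => /=; rewrite linear0 oppr0 addr0.
  by apply/ex; exists y.
have [|s sP] := sp E' i' (snd \o j).
  split.
  - by apply: inj_of_ker => y iy; have := i'P y; rewrite iy linear0 => -[] /esym iy0; apply: iI; rewrite iy0 linear0.
  - move=> x; split=> [/= jx2|[y <-]]; last by rewrite /= i'P.
    have /ex[y iy] : p (j x).1 = 0 by rewrite jE jx2 linear0.
    by exists y; apply: jI; rewrite i'P /= iy; case: (j x) jx2 => /= ? ? ->.
  - move=> x; have [e pe] := ps (h x).
    have /jP[z jz] : lin_copair p (\- h) (e, x) = 0 by rewrite /= pe subrr.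
    by exists z; rewrite /= jz.
exists (fst \o (j \o s)) => x /=; rewrite jE; congr (h _); exact: sP.
Qed.

(** Push an extension [E] of [C] by [Y] out along [j]. The result [G] is an extension of [C] by [A],
    so it has finite projective dimension, and [f] extends to [G] by zero on [E]. Factoring this
    extension through [f] gives [h]; its restriction to [A] is an endomorphism over [S], invertible
    by minimality. Corrected by the inverse, [h] sends [E] into the kernel of [f] and so retracts
    [E] onto [Y]. *)
Lemma wakamatsu S A : minimal_approximation (@Pinfmod R) S A ->
  exists f : {linear A -> S}, Pinfmod A /\ (forall B (g : {linear B -> S}), Pinfmod B -> exists h : {linear B -> A}, forall x, g x = f (h x)) /\
    forall Y (j : {linear Y -> A}), injective j -> mod_exact j f ->
      forall C, Pinfmod C -> ext10 C Y.
Proof.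
move=> [[f [CA apf]] [l lA lmin]]; exists f; split=> //; split=> [B g /apf|Y j jI exj C CC]; first exact.
have bij := minimal_approximation_bij (conj CA apf) lA lmin.
apply: ext10_of_split => E i p s.
have [G [a [J [q [sJ aJ _ _ univ]]]]] := pushout_ses j s.
have [|g [ga gJ]] := univ S \0 f.
  by move=> y /=; symmetry; apply/exj; exists y.
have CG : Pinfmod G by apply: (Pinf_ext sJ).
have [h hP] := apf G CG g.
have fhJ x : f ((h \o J) x) = f x by rewrite /= -hP gJ.
have [v [vh hv]] := bij_lin_inv (bij _ fhJ).
have fv x : f (v x) = f x by rewrite -{2}(hv x) fhJ.
have [w wP] : exists w : {linear E -> Y}, forall e, j (w e) = (v \o h \o a : {linear E -> A}) e.
  apply: factor_inj => // e; apply/exj; by rewrite /= fv -hP ga.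
have wi y : w (i y) = y by apply: jI; rewrite wP /= aJ; exact: vh.
have [iI ex ps] := s.
have [t tP] : exists t : {linear C -> E}, forall e, t (p e) = (idfun \- (i \o w)) e.
  by apply: factor_surj => // e /ex[y <-] /=; rewrite wi subrr.
exists t => c; have [e <-] := ps c.
by rewrite tP linearB /= (proj2 (ex _) (ex_intro _ (w e) erefl)) subr0.
Qed.

End FinitelyGeneratedFiniteDimension.

(** * Filtrations by direct sums *)

Section SumFiltrations.
Variable R : pzRingType.
Implicit Types A B C D E F K M N P Q X Y Z : lmodType R.

(** The map [c] allows any number of copies of each [T j] in a layer. New layers go on top, which is
    the shape that the horseshoe argument and the induction for [sfilt_ext10] require. *)
Inductive sfilt n (T : 'I_n -> lmodType R) : lmodType R -> Prop :=
| sfilt0 X : is0 X -> sfilt T X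
| sfiltS X' X (I : eqType) (c : I -> 'I_n) (f : {linear X' -> X})
    (g : {linear X -> dsum (fun i => T (c i))}) : ses f g -> sfilt T X' -> sfilt T X.

(* A layer may also be added at the bottom, as the socle series requires. *)
Lemma sfilt_bot n (T : 'I_n -> lmodType R) X'' : sfilt T X'' ->
  forall X (I : eqType) (c : I -> 'I_n) (f : {linear dsum (fun i => T (c i)) -> X})
    (g : {linear X -> X''}), ses f g -> sfilt T X.
Proof.
elim=> [{}X'' X0|X1 {}X'' J d f1 g1 s1 _ IH] X I c f g s.
  have [Z Z0] := ex_zero_mod R; have [fI ex _] := s.
  have [|h [fh hf]] := bij_lin_inv (inj_surj_bij fI _).
    by move=> x; apply/ex.
  apply: (sfiltS (X' := Z) (f := \0) (g := h)); last exact: sfilt0.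
  split=> [x y _|x|x]; first by rewrite (Z0 x) (Z0 y).
    split=> [hx|[z <-]]; last by rewrite linear0.
    by exists 0; rewrite /= -[x]hf hx linear0.
  by exists (f x).
have [fI ex gs] := s; have [f1I ex1 g1s] := s1.
have hs : mod_surjective (g1 \o g).
  by move=> z; have [y <-] := g1s z; have [x <-] := gs y; exists x.
have [X2 [i si]] := ses_ker hs; have [iI exi _] := si.
have [f' f'P] : exists f' : {linear _ -> X2}, forall x, i (f' x) = f x.
  by apply: factor_inj => // x; apply/exi; rewrite /= (ses_zero s) linear0.
have [g' g'P] : exists g' : {linear X2 -> X1}, forall x, f1 (g' x) = g (i x).
  by apply: (factor_inj (h := g \o i)) => // x; apply/ex1; exact: (ses_zero si).
apply: (sfiltS si); apply: (IH _ _ _ f' g'); split.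
- by move=> x y e; apply: fI; rewrite -!f'P e.
- move=> x; split=> [gx|[y <-]].
    have /ex[y fy] : g (i x) = 0 by rewrite -g'P gx linear0.
    by exists y; apply: iI; rewrite f'P.
  by apply: f1I; rewrite g'P f'P (ses_zero s) linear0.
- move=> y; have [x gx] := gs (f1 y).
  have /exi[z iz] : (g1 \o g) x = 0 by rewrite /= gx (ses_zero s1).
  by exists z; apply: f1I; rewrite g'P iz.
Qed.

Lemma sfilt_ext10 n (T : 'I_n -> lmodType R) X Y :
  (forall (I : eqType) (c : I -> 'I_n), ext10 X (dsum (fun i => T (c i)))) ->
  sfilt T Y -> ext10 X Y.
Proof.
move=> eX; elim=> [{}Y Y0|Y' {}Y I c f g s _ IH]; first exact: ext10_zero.
exact: ext10_ext s IH (eX I c).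
Qed.

Lemma sfilt_pdle n (T : 'I_n -> lmodType R) m X :
  (forall i, pdle m (T i)) -> sfilt T X -> pdle m X.
Proof.
move=> pT; elim=> [{}X X0|X' {}X I c f g s _ IH]; first exact: pdle0.
by apply: (pdle_ext s IH); apply: pdle_dsum.
Qed.

End SumFiltrations.

(** * Finite filtrations with semisimple layers *)

Section Socle.
Variable R : pzRingType.
Variables (n : nat) (S : 'I_n -> lmodType R).
Hypothesis repS : simple_representatives S.
Local Open Scope classical_set_scope.

(** Take a maximal set [E] of maps from the [S j] whose direct sum embeds in [X]. A map [phi]
    outside [E] enters a nontrivial relation with [E], so its image meets that of [f] in a nonzero
    element, and by simplicity it is contained in it. *)
Lemma socle (X : lmodType R) : exists (I : eqType) (c : I -> 'I_n)
    (f : {linear dsum (fun i => S (c i)) -> X}),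
  injective f /\ forall j (phi : {linear S j -> X}) y, exists z, f z = phi y.
Proof.
pose T : eqType := {classic {j : 'I_n & {linear S j -> X}}}.
pose tg (t : T) : 'I_n := projT1 t.
pose D := dsum (fun t : T => S (tg t)).
have [ev evP] := dsum_lift (fun t : T => projT2 t : {linear S (tg t) -> X}).
pose on (E : set T) (x : D) := forall t, ~ E t -> dpr _ t x = 0.
pose P (E : set T) := forall x : D, on E x -> ev x = 0 -> x = 0.
have [E [PE Emax]] : exists E, P E /\ forall B, E `<` B -> ~ P B.
  apply: Zorn_bigcup => F FP Ft x onx evx.
  have [s sP] := dsum_supp x.
  have [|s0|[E' FE' E's]] := chain_seq (s := [seq t <- s | dpr _ t x != 0]) Ft.
  - by move=> t; rewrite mem_filter => /andP[/eqP nz _]; apply: contrapT => /onx.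
  - apply: dsum_ext => t; rewrite linear0; apply/eqP; apply: contraT => nz.
    suff : t \in [seq t <- s | dpr _ t x != 0] by rewrite s0.
    by rewrite mem_filter nz; apply: contraT => /sP e; rewrite e eqxx in nz.
  - apply: (FP E' FE' x) => // t nE; apply: contrapT => /eqP nz; apply: nE.
    by apply: E's; rewrite mem_filter nz; apply: contraT => /sP e; rewrite e eqxx in nz.
pose I : eqType := {classic {t : T | E t}}.
pose iv (i : I) : T := sval i.
have ivI : injective iv by move=> [t Et] [u Eu] /= e; exact: eq_exist.
pose c (i : I) := tg (iv i).
have [m mP] := dsum_lift (M := fun i => S (c i)) (fun i : I => dinj (fun t : T => S (tg t)) (iv i)).
have mon x : on E (m x).
  move=> t nE; have := dsum_hom_ext (f := dpr _ t \o m) (g := \0).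
  apply=> i y /=; rewrite mP dpr_dinj_neq //.
  by apply/eqP => e; apply: nE; rewrite -e; exact: (svalP i).
have mpr i x : dpr _ (iv i) (m x) = dpr _ i x.
  have := dsum_hom_ext (f := dpr _ (iv i) \o m) (g := dpr _ i).
  apply=> j y /=; rewrite mP; have [e|ne] := eqVneq j i; first by case: i / e; rewrite !dpr_dinj.
  by rewrite !dpr_dinj_neq //; apply: contraNneq ne => /ivI->.
pose f := ev \o m.
have fE w : on E w -> exists z, f z = ev w.
  move=> onw; have [s us sP] := dsum_suppu w.
  rewrite (dsum_decomp us sP) linear_sum; apply: (smod_sum _ (smod_range f)) => t.
  case: (pselect (E t)) => [Et|/onw ->]; last by exists 0; rewrite !linear0.
  exists (dinj _ (exist _ t Et : I) (dpr (fun t : T => S (tg t)) t w)).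
  by rewrite /f /= mP.
exists I, c, f; split.
  apply: inj_of_ker => x fx; apply: dsum_ext => i.
  by rewrite -mpr (PE (m x)) ?linear0.
move=> j phi y; pose t : T := existT _ j phi.
case: (pselect (E t)) => [Et|nEt].
  have [|z fz] := fE (dinj (fun t : T => S (tg t)) t y).
    by move=> u nu; rewrite dpr_dinj_neq //; apply/eqP => e; apply: nu; rewrite -e.
  by exists z; exact: etrans fz (evP t y).
have [x [onx evx xn]] : exists x, [/\ on (E `|` [set t]) x, ev x = 0 & x <> 0].
  apply: contrapT => nex; apply: (Emax (E `|` [set t])).
    by split=> [u Eu|h]; [left | apply: nEt; apply: h; right].
  by move=> x onx evx; apply: contrapT => xn; apply: nex; exists x.
pose y0 := dpr _ t x : S j.
have y0n : y0 <> 0.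
  move=> y00; apply: xn; apply: PE => // u nu.
  case: (pselect (u = t)) => [->//|ut]; by apply: onx => -[].
have [z fz] : exists z, f z = phi y0.
  have [|z fz] := fE (dinj (fun t : T => S (tg t)) t y0 - x).
    move=> u nu; rewrite linearB /=; case: (eqVneq t u) => [<-|tu].
      by rewrite dpr_dinj subrr.
    rewrite (dpr_dinj_neq (M := fun t : T => S (tg t)) _ tu) onx ?subr0 // => -[//|ut].
    by rewrite ut eqxx in tu.
  exists z; apply: etrans fz _; rewrite linearB /= evx subr0; exact: (evP t y0).
have [simS _ _] := repS; have /simple_modP[_ sm] := simS j.
have [h|h] := sm _ (smod_preim phi (smod_range f)); last exact: h.
by case: y0n; apply: h; exists z.
Qed.

Hypothesis finR : finlen (R^o : lmodType R).

(** Dividing by the socle strictly enlarges the annihilator of every element that is not killed. The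
    number of layers is therefore bounded by the rank of [R], uniformly in the elements of [X]. *)
Lemma sfilt_simple (X : lmodType R) : sfilt S X.
Proof.
have [l lP] := finR;
pose ann (X : lmodType R) (x : X) : set (R^o : lmodType R) := fun a => (a : R) *: x = 0.
have annS (Z : lmodType R) (x : Z) : smod (ann Z x) := smod_ker (linscale x).
have TS : smod (setT : set (R^o : lmodType R)) by [].
suff H m : forall Z : lmodType R, (forall x : Z, l setT <= l (ann Z x) + m)%N -> sfilt S Z.
  by apply: (H (l setT)) => x; apply: leq_addl.
elim: m => [|m IH] Z lZ.
  apply: sfilt0 => x; apply: contrapT => xn.
  have := lZ x; rewrite addn0 leqNgt => /negP; apply; apply: lP => //.
  by move=> /(_ 1 I); rewrite /ann scale1r.
have [J0 [c [f [fI fS]]]] := socle Z.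
have [Q [g s]] := ses_coker fI; have [_ ex gs] := s.
apply: (sfilt_bot (X'' := Q) _ s); apply: IH => y; have [x <-] := gs y.
have sub : ann Z x `<=` ann Q (g x) by move=> a ax; rewrite /ann -linearZ /= ax linear0.
case: (pselect (ann Q (g x) `<=` ann Z x)) => [sub'|nsub]; last first.
  by apply: leq_trans (lZ x) _; rewrite addnS -addSn leq_add2r; apply: lP.
suff -> : ann Q (g x) = setT by apply: leq_addr.
apply/seteqP; split=> // a _; rewrite /ann.
suff -> : g x = 0 by rewrite scaler0.
clear a.
apply: contrapT => gxn.
(* A left ideal [J] of least rank strictly above the annihilator of [x] makes [J x] simple. It then
   lies in the socle, so [J] annihilates [g x], contrary to [sub']. *)
pose T (J : set (R^o : lmodType R)) := [/\ smod J, ann Z x `<=` J & ~ J `<=` ann Z x].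
have [|J [HJ aJ nJ] Jmin] := ex_min_nat (P := T) l.
  exists setT; split=> // h; apply: gxn; have := h 1 I; rewrite /ann scale1r => ->.
  by rewrite linear0.
have [N [i [iI iP]]] := ex_sub (smod_image (linscale x) HJ).
have [b Jb nb] : exists2 b, J b & ~ ann Z x b.
  by apply: contrapT => nex; apply: nJ => b Jb; apply: contrapT => nb; apply: nex; exists b.
have simN : simple_mod N.
  apply/simple_modP; split.
    have [v iv] : exists v, i v = (b : R) *: x by apply/iP; exists b.
    by exists v; apply/eqP => v0; apply: nb; rewrite /ann -iv v0 linear0.
  move=> U HU; pose J' : set (R^o : lmodType R) := fun a => J a /\ exists2 u, U u & i u = (a : R) *: x.
  have HJ' : smod J' := smodI HJ (smod_preim (linscale x) (smod_image i HU)).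
  case: (pselect (J' `<=` ann Z x)) => [h|h]; [left=> u Uu | right=> u].
    have [a Ja /= ax] : exists2 a, J a & linscale x a = i u by apply/iP; exists u.
    apply: iI; rewrite linear0 -ax; apply: h; split=> //; by exists u.
  have JJ' : J `<=` J'.
    apply: contrapT => nn.
    have : (l J' < l J)%N by apply: lP => // a [].
    rewrite ltnNge => /negP; apply; apply: Jmin; split=> // a ax; split; first exact: aJ.
    by exists 0; [case: HU | rewrite linear0 ax].
  have [a Ja /= ax] : exists2 a, J a & linscale x a = i u by apply/iP; exists u.
  have [_ [u' Uu' iu']] := JJ' a Ja.
  by have -> : u = u' by apply: iI; rewrite iu' ax.
have [_ _ rep] := repS; have [j /mod_iso_sym[phi phib]] := rep N simN.
have [v iv] : exists v, i v = (b : R) *: x by apply/iP; exists b.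
have [w phiw] : exists w, phi w = v by case: phib => p _ pp; exists (p v).
have [z fz] := fS j (i \o phi) w.
apply: nb; apply: sub'; rewrite /ann -linearZ /= -iv -phiw -[i _]/((i \o phi) w) -fz.
exact: (ses_zero s).
Qed.

End Socle.

(** * Approximation sequences for arbitrary modules *)

Section Approximations.
Variable R : pzRingType.
Hypothesis finR : finlen (R^o : lmodType R).
Variables (n : nat) (S A Yk : 'I_n -> lmodType R).
Variables (jk : forall t, {linear Yk t -> A t}) (fk : forall t, {linear A t -> S t}).
Hypothesis sk : forall t, ses (jk t) (fk t).
Hypothesis CA : forall t, Pinfmod (A t).
Hypothesis extY : forall t B, Pinfmod B -> ext10 B (Yk t).

(** The kernel [V] of a finite free presentation of [B] is finitely generated, so a map from [V] to
    the sum involves finitely many summands and is extended in each of them. *)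
Lemma ext10_dsumY (B : lmodType R) (I : eqType) (c : I -> 'I_n) :
  Pinfmod B -> ext10 B (dsum (fun i => Yk (c i))).
Proof.
move=> CB; have [m [p ps]] := fin_gen_cover (proj1 CB).
have [V [i s]] := ses_ker ps.
apply: (ext10_of_extend (@free_projective _ _) s) => u.
have fV : fin_gen V by have [iI _ _] := s; exact: (fin_gen_sub finR iI (@fin_gen_free _ _)).
have [t tP] := fin_gen_dsum_supp u fV.
have vex k : exists v : {linear freemod R 'I_m -> Yk (c k)},
    (forall x, v (i x) = dpr _ k (u x)) /\ (k \notin t -> forall x, v x = 0).
  case: (boolP (k \in t)) => kt.
    by have [v vP] := ext10_extend (dpr (fun i => Yk (c i)) k \o u) s (@extY (c k) B CB); exists v.
  by exists \0; split=> // x; rewrite tP.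
have [v vP] := dep_choice vex.
have [w wP] := dsum_colift (fun k => proj2 (vP k)).
exists w => x; apply: dsum_ext => k; rewrite wP; exact: (proj1 (vP k)).
Qed.

Lemma ext10_sfiltY (B Y : lmodType R) : Pinfmod B -> sfilt Yk Y -> ext10 B Y.
Proof. by move=> CB; apply: sfilt_ext10 => I c; apply: ext10_dsumY. Qed.

(** The sum of the [A (c i)] is not projective, so its map to the top layer need not lift to [X].
    The obstruction to a horseshoe lies in [Ext^2] of this sum with [Y'], that is, in [Ext^1] of the
    sum of the first syzygies [U (c i)], which again have finite projective dimension. *)
Lemma sfilt_approximation (X : lmodType R) : sfilt S X ->
  exists (C Y : lmodType R) (i : {linear Y -> C}) (p : {linear C -> X}),
    [/\ ses i p, sfilt A C & sfilt Yk Y].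
Proof.
elim=> [{}X X0|X' {}X I c f g s _ [C' [Y' [i' [p' [s' FC' FY']]]]]].
  exists X, X, \0, idfun; split; [exact: ses_id | exact: sfilt0 | exact: sfilt0].
have [f1 [q1 [sD f1P q1P]]] := dsum_ses (fun i => sk (c i)).
have cov t : exists (m : nat) (U : lmodType R) (j : {linear U -> freemod R 'I_m}) (e : {linear freemod R 'I_m -> A t}), ses j e.
  have [m [e es]] := fin_gen_cover (proj1 (CA t)).
  by have [U [j sj]] := ses_ker es; exists m, U, j, e.
have [m mP] := choice cov; have [U UP] := dep_choice mP.
have [j jP] := dep_choice UP; have [e eP] := dep_choice jP.
have [J [G [sQ _ _]]] := dsum_ses (fun i => eP (c i)).
have CU t : Pinfmod (U t).
  exact: (Pinf_kernel finR (eP t) (@free_projective _ _) (@fin_gen_free _ _) (CA t)).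
have pQ : projective_mod (dsum (fun i => freemod R 'I_(m (c i)))).
  by apply: projective_dsum => i; exact: free_projective.
have [fI ex gs] := s.
have [q qP] := pQ _ _ g (q1 \o G) gs.
have [u uP] : exists u : {linear dsum (fun i => U (c i)) -> X'}, forall x, f (u x) = q (J x).
  apply: (factor_inj (h := q \o J)) => // x; apply/ex.
  by rewrite /= qP /= (ses_zero sQ) linear0.
have eU : ext10 (dsum (fun i => U (c i))) Y'.
  by apply: ext10_dsum => i; apply: ext10_sfiltY.
(* The obstruction vanishes: [u] lifts to [C'], and the pushout of the free cover along this lift is
   the required extension of the sum of the [A (c i)] by [C']. *)
have [v vP] := eU _ _ _ _ s' u.
have [C [a [b [r [sC ab ra span univ]]]]] := pushout_ses v sQ.
have [|p [pa pb]] := univ X q (f \o p').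
  by move=> x; rewrite /= vP uP.
have gp x : g (p x) = q1 (r x).
  have [y [z ->]] := span x; rewrite !linearD /= pa pb qP /= (ses_zero s) (ses_zero sC) ra.
  by rewrite linear0.
have [_ exp' p's] := s'; have [_ exQ Gs] := sQ; have [bI exC rs] := sC.
have [q1I exD q1s] := sD.
have ps : mod_surjective p.
  move=> x; have [d q1d] := q1s (g x); have [y Gy] := Gs d.
  have /ex[x' fx'] : g (x - q y) = 0 by rewrite linearB /= qP /= Gy q1d subrr.
  have [c' pc'] := p's x'; exists (a y + b c').
  by rewrite linearD /= pa pb /= pc' fx' addrC subrK.
have [Y [i sY]] := ses_ker ps; have [iI exi _] := sY.
exists C, Y, i, p; split=> //; first exact: sfiltS sC FC'.
have [k kP] : exists k : {linear Y' -> Y}, forall y, i (k y) = b (i' y).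
  apply: (factor_inj (h := b \o i')) => // y; apply/exi.
  by rewrite /= pb /= (ses_zero s') linear0.
have [h hP] : exists h : {linear Y -> dsum (fun i => Yk (c i))}, forall y, f1 (h y) = r (i y).
  apply: (factor_inj (h := r \o i)) => // y; apply/exD.
  by rewrite /= -gp (ses_zero sY) linear0.
apply: (sfiltS (f := k) (g := h)) FY'; split.
- have [i'I _ _] := s'; move=> x y kxy; apply: i'I; apply: bI; by rewrite -!kP kxy.
- move=> y; split=> [hy|[z <-]]; last first.
    by apply: q1I; rewrite hP kP (ses_zero sC) linear0.
  have /exC[c' bc'] : r (i y) = 0 by rewrite -hP hy linear0.
  have /exp'[y' iy'] : p' c' = 0.
    by apply: fI; rewrite linear0 -[f _]/((f \o p') c') -pb bc' (ses_zero sY).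
  by exists y'; apply: iI; rewrite kP iy'.
- move=> d; have [y Gy] := Gs (f1 d).
  have /ex[x' fx'] : g (q y) = 0 by rewrite qP /= Gy; exact: (ses_zero sD).
  have [c' pc'] := p's x'.
  have /exi[z iz] : p (a y - b c') = 0.
    by rewrite linearB /= pa pb /= pc' fx' subrr.
  exists z; apply: q1I; rewrite hP iz linearB /= ra (ses_zero sC) subr0.
  exact: Gy.
Qed.

End Approximations.

(** * Compactness *)

Section Compactness.
Variable R : pzRingType.
Implicit Types A B C D K M N P Q X W : lmodType R.
Local Open Scope classical_set_scope.

(** Lazard's criterion: for the classes used here it characterizes the direct limits of modules in
    [T], see [factors_direct_limit] and [limit_factors]. *)
Definition factors_through (T : lmodType R -> Prop) X : Prop :=
  forall N (a : {linear N -> X}), fin_gen N ->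
    exists B (b : {linear N -> B}) (d : {linear B -> X}), T B /\ forall x, d (b x) = a x.

Lemma fin_gen_regular : fin_gen (R^o : lmodType R).
Proof.
exists 1%N, (fun=> 1) => x; exists (fun=> x); rewrite big_ord1.
by rewrite -[RHS]/(x * 1) mulr1.
Qed.

Section Lifting.
Variables (n : nat) (Y : 'I_n -> lmodType R).
Hypothesis endoY : forall j, endofin (Y j).
Variables (I : eqType) (c : I -> 'I_n).
Let Z := dsum (fun i => Y (c i)).
Hypothesis extZ : forall B, Pinfmod B -> ext10 B Z.
Variable X : lmodType R.
Hypothesis factX : factors_through (@Pinfmod R) X.
Variables (E D : lmodType R) (i : {linear Z -> E}) (g : {linear E -> D}).
Hypothesis sg : ses i g.
Variable h : {linear X -> D}.

(* [G] is a partial lift of [h], every finite part of which extends to any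
   finitely generated module over [X]. *)
Definition finite_lifts (G : set (X * E)) : Prop :=
  forall N (a : {linear N -> X}) (F : seq (N * E)), fin_gen N ->
    (forall p, p \in F -> G (a p.1, p.2)) ->
    exists t : {linear N -> E}, (forall x, g (t x) = h (a x)) /\ forall p, p \in F -> t p.1 = p.2.

(* A matrix subgroup (pp-definable subgroup) of [W]. *)
Definition ppsub N (F : seq (N * E)) (x : N) W : set W :=
  fun w => exists2 f : {linear N -> W}, (forall p, p \in F -> f p.1 = 0) & f x = w.

Lemma ppsub_endo N (F : seq (N * E)) x W : endosub (ppsub F x (W := W)).
Proof.
split=> [|_ _ [f1 k1 <-] [f2 k2 <-]|u _ [f kf <-]].
- by exists \0.
- by exists (f1 \+ f2) => // p pF; rewrite /= k1 // k2 // addr0.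
- by exists (u \o f) => // p pF; rewrite /= kf // linear0.
Qed.

(** The factorization property enters here: [h \o d] lifts because [B] is finitely generated of
    finite projective dimension. *)
Lemma finite_lifts0 : finite_lifts set0.
Proof.
move=> N a [|p F] fN aF; last by have := aF p (mem_head _ _).
have [B [b [d [CB dE]]]] := factX a fN.
have [t tP] := extZ CB sg (h \o d).
by exists (t \o b); split=> // x; rewrite /= tP /= dE.
Qed.

Lemma ex_finite_lifts_max : exists G, finite_lifts G /\ forall G', G `<` G' -> ~ finite_lifts G'.
Proof.
apply: Zorn_bigcup => F FP Ft N a s fN as_.
have [|s0|[G FG Gs]] := chain_seq (s := [seq (a p.1, p.2) | p <- s]) Ft.
- by move=> _ /mapP[p ps ->]; apply: as_.
- by apply: finite_lifts0 => // p ps; have := map_f (fun p => (a p.1, p.2)) ps; rewrite s0.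
- by apply: (FP G FG) => // p ps; apply: Gs; apply: (map_f (fun p => (a p.1, p.2)) ps).
Qed.

(* The admissible values at [x] imposed by finite data form a downward directed
   family of cosets of pp-subgroups; [e] is a point of a smallest one. *)
Lemma finite_lifts_extend G x : finite_lifts G -> exists e, finite_lifts (fun p => G p \/ p = (x, e)).
Proof.
move=> PG; have [l lP] := dep_choice endoY.
(* The sum runs over the finitely many modules [Y j], not over the summands of [Z], so one minimum
   controls every coordinate of [Z]. *)
pose rk N (F : seq (N * E)) y := (\sum_(j < n) l j (ppsub F y (W := Y j)))%N.
pose data N (a : {linear N -> X}) (F : seq (N * E)) y :=
  [/\ fin_gen N, (forall p, p \in F -> G (a p.1, p.2)) & a y = x].
have [|m [N0 [a0 [F0 [y0 [[fN0 GF0 ay0] rk0]]]]] mmin] :=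
    @ex_min_nat nat (fun m => exists N (a : {linear N -> X}) F y, data N a F y /\ rk N F y = m) id.
  exists (rk (R^o : lmodType R) [::] (1 : R^o)), (R^o : lmodType R), (linscale x), [::], (1 : R^o).
  by split=> //; split=> //; [exact: fin_gen_regular | rewrite /= scale1r].
have [t0 [gt0 t0F]] := PG N0 a0 F0 fN0 GF0.
exists (t0 y0) => N a F fN aF.
pose F1 := [seq p <- F | `[< G (a p.1, p.2) >]].
(* [M] amalgamates [N] with [N0], identifying with [y0] every constrained element of [N] that lies
   over [x]. *)
pose K : set (N * N0)%type := sspan (fun z => exists2 p : N * E, a p.1 = x /\ p \in F & z = (p.1, - y0)).
have [M [w [ws wK]]] := ex_quot (smod_sspan _ : smod K).
pose w1 : {linear N -> M} := w \o lin_pair idfun \0.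
pose w2 : {linear N0 -> M} := w \o lin_pair \0 idfun.
have wE u v : w (u, v) = w1 u + w2 v.
  by rewrite /w1 /w2 /= -linearD /= -[RHS]/(w (u + 0, 0 + v)) addr0 add0r.
have [aM aMP] : exists aM : {linear M -> X}, forall z, aM (w z) = lin_copair a a0 z.
  apply: factor_surj ws _ => z /wK Kz.
  apply: (sspan_min (smod_ker (lin_copair a a0)) _ Kz) => _ [p [ap _] ->] /=.
  by rewrite linearN /= ay0 ap subrr.
have aM1 u : aM (w1 u) = a u by rewrite aMP /= linear0 addr0.
have aM2 u : aM (w2 u) = a0 u by rewrite aMP /= linear0 add0r.
have w12 p : p \in F -> a p.1 = x -> w1 p.1 = w2 y0.
  move=> pF ap; apply/eqP; rewrite -subr_eq0 -linearN /= -wE; apply/eqP/wK.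
  by apply: sub_sspan; exists p.
clearbody w1 w2.
pose FM := [seq (w1 p.1, p.2) | p <- F1] ++ [seq (w2 p.1, p.2) | p <- F0].
have fM : fin_gen M by apply: fin_gen_surj ws _; exact: fin_gen_prod.
have GFM p : p \in FM -> G (aM p.1, p.2).
  rewrite mem_cat => /orP[] /mapP[q + ->] /=; last by rewrite aM2 => /GF0.
  by rewrite mem_filter aM1 => /andP[/asboolP].
have HMsub W : ppsub FM (w2 y0) (W := W) `<=` ppsub F0 y0 (W := W).
  move=> _ [f kf <-]; exists (f \o w2) => // p pF /=.
  by apply: (kf (w2 p.1, p.2)); rewrite mem_cat (map_f (fun p => (w2 p.1, p.2)) pF) orbT.
(* The data on [M] refine those on [N0], so their pp-subgroups are smaller; by minimality of the
   total rank none of them shrinks. *)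
have HM j : ppsub F0 y0 (W := Y j) `<=` ppsub FM (w2 y0) (W := Y j).
  apply: contrapT => nsub.
  have : (m <= rk M FM (w2 y0))%N.
    apply: mmin; exists M, aM, FM, (w2 y0); split=> //; split=> //; by rewrite aM2.
  rewrite leqNgt -rk0 => /negP; apply; rewrite /rk (bigD1 j) //= [ltnRHS](bigD1 j) //= -addSn.
  apply: leq_add; first by apply: lP => //; exact: ppsub_endo.
  apply: leq_sum => j' _; case: (pselect (ppsub F0 y0 (W := Y j') `<=` ppsub FM (w2 y0) (W := Y j'))) => [sub|nsub'].
    by have -> : ppsub F0 y0 (W := Y j') = ppsub FM (w2 y0) (W := Y j') by apply/seteqP.
  by apply: ltnW; apply: lP => //; exact: ppsub_endo.
have [t [gt tF]] := PG M aM FM fM GFM.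
have [iI ex _] := sg.
(* The lift [t] obtained on [M] may miss the value [t0 y0]. The error [d] lies in [Z] and kills the
   data [F0], so the coordinates of [d y0] belong to the minimal pp-subgroups and are values of maps
   defined on [M]. *)
have [d dP] : exists d : {linear N0 -> Z}, forall y, i (d y) = (t \o w2 \- t0) y.
  apply: factor_inj => // y; apply/ex; by rewrite linearB /= gt gt0 aM2 subrr.
have dF p : p \in F0 -> d p.1 = 0.
  move=> pF; apply: iI; rewrite linear0 dP /= t0F // (tF (w2 p.1, p.2)) ?subrr //.
  by rewrite mem_cat (map_f (fun p => (w2 p.1, p.2)) pF) orbT.
have [s sP] := dsum_supp (d y0).
(* Off the support of [d y0] the zero map is taken, so that the coordinate maps assemble into a map
   to the direct sum. *)
have ex_psi k : exists f : {linear M -> Y (c k)}, [/\ forall p, p \in FM -> f p.1 = 0,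
    f (w2 y0) = dpr _ k (d y0) & k \notin s -> forall z, f z = 0].
  case: (boolP (k \in s)) => ks; last by exists \0; split=> //; rewrite sP.
  have [|f kf fy] := HM (c k) (dpr _ k (d y0)); last by exists f.
  by exists (dpr _ k \o d) => // p pF; rewrite /= dF // linear0.
have [f fP] := dep_choice ex_psi.
have [|psi psiP] := dsum_colift (h := f) (s := s); first by move=> k; case: (fP k).
have psiF p : p \in FM -> psi p.1 = 0.
  by move=> pF; apply: dsum_ext => k; rewrite psiP linear0; case: (fP k) => kf _ _; apply: kf.
have psiy : psi (w2 y0) = d y0.
  by apply: dsum_ext => k; rewrite psiP; case: (fP k).
have gi z : g (i z) = 0 := ses_zero sg z.
exists ((t \- (i \o psi)) \o w1); split=> [y|p pF].
  by rewrite /= linearB /= gi subr0 gt aM1.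
have [Gp|[ap ep]] := aF p pF.
  have p1 : (w1 p.1, p.2) \in FM.
    by rewrite mem_cat (map_f (fun p => (w1 p.1, p.2))) // mem_filter pF andbT; apply/asboolP.
  by rewrite /= (tF _ p1) (psiF _ p1) linear0 subr0.
by rewrite /= (w12 p) // psiy dP /= ep opprB addrC subrK.
Qed.

Lemma lift_exists : exists h' : {linear X -> E}, forall x, g (h' x) = h x.
Proof.
have [G [PG Gmax]] := ex_finite_lifts_max.
have /choice[s sP] x : exists e, G (x, e).
  have [e Pe] := finite_lifts_extend x PG; exists e; apply: contrapT => nG.
  case: (Gmax _ _ Pe); split=> [p Gp|sub]; [by left | by apply: nG; apply: sub; right].
have sl : linear s.
  move=> b x y.
  (* One linear map on [R * R] takes the values [s x], [s y] and [s (b *: x + y)], which forces the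
     linear relation between them. *)
  have [|p|t [_ tF]] := PG (R^o * R^o)%type (lin_copair (linscale x) (linscale y))
    [:: ((1, 0), s x); ((0, 1), s y); ((b, 1), s (b *: x + y))].
  - by apply: fin_gen_prod; exact: fin_gen_regular.
  - by rewrite !inE => /or3P[] /eqP-> /=; rewrite ?scale1r ?scale0r ?addr0 ?add0r.
  have e1 : t (1, 0) = s x := tF ((1, 0), s x) (mem_head _ _).
  have e2 : t (0, 1) = s y by apply: (tF ((0, 1), s y)); rewrite !inE eqxx orbT.
  have <- : t (b, 1) = s (b *: x + y).
    by apply: (tF ((b, 1), s (b *: x + y))); rewrite !inE eqxx !orbT.
  rewrite -e1 -e2 -linearZ -linearD; congr (t _).
  by congr (_, _); rewrite /= ?addr0 ?scaler0 ?add0r // -[b *: _]/(b * 1) mulr1.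
exists (mklin sl) => x /=.
have [|p|t [gt tF]] := PG (R^o : lmodType R) (linscale x) [:: ((1 : R^o), s x)].
- exact: fin_gen_regular.
- by rewrite inE => /eqP-> /=; rewrite scale1r.
have <- : t (1 : R^o) = s x := tF ((1 : R^o), s x) (mem_head _ _).
by rewrite gt /= scale1r.
Qed.

End Lifting.

Lemma factors_ext10 n (Y : 'I_n -> lmodType R) :
  (forall j, endofin (Y j)) ->
  (forall B (I : eqType) (c : I -> 'I_n), Pinfmod B -> ext10 B (dsum (fun i => Y (c i)))) ->
  forall X W, factors_through (@Pinfmod R) X -> sfilt Y W -> ext10 X W.
Proof.
move=> eY xY X W fX; apply: sfilt_ext10 => I c E D i g s h.
by apply: (lift_exists eY _ fX s) => B; apply: xY.
Qed.

End Compactness.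

(** * Finite filtrations and factorizations *)

Section FiniteFiltrations.
Variable R : pzRingType.
Implicit Types A B C D E F K M N P Q X Y Z W : lmodType R.

(* [Q] is isomorphic to [U / V]. *)
Definition section_of M (U V : set M) Q : Prop :=
  exists K (k : {linear K -> M}) (g : {linear K -> Q}),
    [/\ injective k, forall y, U y <-> exists x, k x = y, mod_surjective g &
        forall x, g x = 0 <-> V (k x)].

Lemma factmod_section M (U V : submodClosed M) :
  section_of (fun x => x \in U) (fun x => x \in V) (factmod U V).
Proof.
have [g [gs gP]] := factmod_pi U V.
exists (submod_of U), val, g; split=> //; first exact: val_inj.
by move=> y; split=> [Uy|[x <-]]; [exists (Submod Uy) | exact: (valP x)].
Qed.

Lemma section_iso_trans M (U V : set M) Q Q' : mod_iso Q Q' -> section_of U V Q -> section_of U V Q'.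
Proof.
move=> [f fb] [K [k [g [kI kU gs gV]]]]; exists K, k, (f \o g); split=> // [y|x].
  by case: fb => p fp pf; have [x gx] := gs (p y); exists x; rewrite /= gx.
by rewrite -gV /=; split=> [h|->]; [apply: (bij_inj fb); rewrite h linear0 | exact: linear0].
Qed.

Lemma section_unique M (U V : set M) Q Q' : section_of U V Q -> section_of U V Q' -> mod_iso Q Q'.
Proof.
move=> [K [k [g [kI kU gs gV]]]] [K' [k' [g' [kI' kU' gs' gV']]]].
have [u uP] : exists u : {linear K -> K'}, forall x, k' (u x) = k x.
  by apply: factor_inj => // x; apply/kU'/kU; exists x.
have [f fP] : exists f : {linear Q -> Q'}, forall x, f (g x) = g' (u x).
  by apply: (factor_surj (h := g' \o u)) => // x /gV Vx; apply/gV'; rewrite uP.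
exists f; apply: inj_surj_bij => [|y].
  apply: inj_of_ker => q; have [x <-] := gs q; rewrite fP => /gV'.
  by rewrite uP => Vx; apply/gV.
have [x' <-] := gs' y; have /kU[x kx] : U (k' x') by apply/kU'; exists x'.
by exists (g x); rewrite fP; congr (g' _); apply: kI'; rewrite uP.
Qed.

Lemma section_image M M' (f : {linear M -> M'}) (U V : set M) Q : injective f ->
  section_of U V Q ->
  section_of (fun y => exists2 x, U x & f x = y) (fun y => exists2 x, V x & f x = y) Q.
Proof.
move=> fI [K [k [g [kI kU gs gV]]]]; exists K, (f \o k), g; split=> //.
- by move=> x y /fI/kI.
- move=> y; split=> [[x /kU[z <-] <-]|[z <-]]; first by exists z.
  by exists (k z) => //; apply/kU; exists z.
- move=> x; split=> [/gV Vk|[z Vz /fI zk]]; first by exists (k x).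
  by apply/gV; rewrite -zk.
Qed.

Variables (n : nat) (A : 'I_n -> lmodType R).

Definition schain X (U : nat -> set X) r : Prop :=
  [/\ forall i, smod (U i), forall x, U 0%N x, forall x, U r x -> x = 0,
      forall i, (i < r)%N -> forall x, U i.+1 x -> U i x &
      forall i, (i < r)%N -> exists j, section_of (U i) (U i.+1) (A j)].

Lemma has_filtrationP X r :
  has_filtration (fun F => exists j, mod_iso F (A j)) X r <-> exists U : nat -> set X, schain U r.
Proof.
split=> [[U [U0 Ur Ud Uf]]|[U [HU U0 Ur Ud Uf]]].
  exists (fun i x => x \in U i); split=> [i|x|x|i il x|i il].
  - exact: submod_smod.
  - by rewrite U0.
  - by rewrite Ur => /eqP.
  - exact: Ud.
  - have [j ij] := Uf i il; exists j; apply: section_iso_trans ij _; exact: factmod_section.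
exists (fun i => mksub (HU i)); split=> [x|x|i il x|i il].
- exact/mksubP.
- apply/idP/eqP => [/mksubP/Ur //|->]; apply/mksubP; by case: (HU r).
- by move=> /mksubP xU; apply/mksubP; apply: Ud.
- have e j : ((fun x => x \in mksub (HU j)) : set X) = U j.
    by apply/seteqP; split=> x /mksubP.
  have [j ij] := Uf i il; exists j; apply: section_unique ij.
  by have := factmod_section (mksub (HU i)) (mksub (HU i.+1)); rewrite !e.
Qed.

Lemma filt_zero X : is0 X -> filt A X.
Proof.
move=> X0; split; first exact: fin_gen0.
exists 0%N; apply/has_filtrationP; exists (fun=> setT); split=> // x _; exact: X0.
Qed.

Lemma filt_iso X X' : mod_iso X X' -> filt A X -> filt A X'.
Proof.
move=> [f fb] [fX [r /has_filtrationP[U [HU U0 Ur Ud Uf]]]]; have fI := bij_inj fb.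
have fs : mod_surjective f by case: fb => p fp pf y; exists (p y).
split; first exact: fin_gen_surj fs fX.
exists r; apply/has_filtrationP; exists (fun i y => exists2 x, U i x & f x = y); split.
- by move=> i; exact: smod_image.
- by move=> y; have [x <-] := fs y; exists x.
- by move=> _ [x /Ur-> <-]; exact: linear0.
- by move=> i il _ [x /Ud Ux <-]; exists x => //; apply: Ux.
- by move=> i il; have [j sj] := Uf i il; exists j; exact: section_image.
Qed.

Lemma filt_ext X' X j (f : {linear X' -> X}) (g : {linear X -> A j}) :
  ses f g -> fin_gen (A j) -> filt A X' -> filt A X.
Proof.
move=> [fI ex gs] fA [fX [r /has_filtrationP[U [HU U0 Ur Ud Uf]]]].
split; first exact: fin_gen_ext ex gs fX fA.
exists r.+1; apply/has_filtrationP.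
exists (fun i => if i is i'.+1 then fun y => exists2 x, U i' x & f x = y else setT); split=> //.
- by case=> [|i]; [split | exact: smod_image].
- by move=> _ [x /Ur-> <-]; exact: linear0.
- by case=> [//|i] il _ [x Ux <-]; exists x => //; apply: Ud.
- case=> [|i] il; last by have [t st] := Uf i il; exists t; exact: section_image.
  exists j, X, idfun, g; split=> //; first by move=> y; split=> // _; exists y.
  move=> x; rewrite (ex x); split=> [[y fy]|[y _ fy]]; by exists y.
Qed.

Lemma filt_Pinf X : (forall j, Pinfmod (A j)) -> filt A X -> Pinfmod X.
Proof.
move=> CA [fX [r /has_filtrationP[U [HU U0 Ur Ud Uf]]]].
suff H d : (d <= r)%N -> exists K (k : {linear K -> X}),
    [/\ injective k, forall y, U (r - d)%N y <-> exists x, k x = y & Pinfmod K].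
  have [K [k [kI kU CK]]] := H r (leqnn r).
  have ks : mod_surjective k by move=> x; apply/kU; rewrite subnn.
  apply: Pinf_retract CK; apply: mod_iso_retract; apply: mod_iso_sym.
  by exists k; apply: inj_surj_bij.
elim: d => [|d IH] dr.
  have [K [k [kI kU]]] := ex_sub (HU r); exists K, k; rewrite subn0; split=> //.
  apply: Pinf_zero => x; apply: kI; rewrite linear0; apply: Ur; apply/kU; by exists x.
have [K1 [k1 [k1I k1U C1]]] := IH (ltnW dr).
have e : (r - d = (r - d.+1).+1)%N by rewrite subnS prednK // subn_gt0.
have il : (r - d.+1 < r)%N by rewrite -e leq_subr.
have [j [K [k [g [kI kU gs gV]]]]] := Uf _ il.
exists K, k; split=> //.
have [u uP] : exists u : {linear K1 -> K}, forall x, k (u x) = k1 x.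
  by apply: factor_inj => // x; apply/kU; apply: (Ud _ il); rewrite -e; apply/k1U; exists x.
apply: (Pinf_ext (f := u) (g := g)) => //; split=> //.
- by move=> x y xy; apply: k1I; rewrite -!uP xy.
- move=> x; rewrite gV -e k1U; split=> [[y ky]|[y <-]]; exists y; last by rewrite uP.
  by apply: kI; rewrite uP.
Qed.

(** Unlike in [factors_through], [d] is injective, so [M] is a directed union; [locally_filt_ext]
    and [coker_factors] need this to recognize kernels inside [M]. *)
Definition locally (T : lmodType R -> Prop) M : Prop :=
  forall N (a : {linear N -> M}), fin_gen N ->
    exists B (b : {linear N -> B}) (d : {linear B -> M}),
      [/\ T B, injective d & forall x, d (b x) = a x].

Hypothesis finR : finlen (R^o : lmodType R).
Hypothesis fA : forall j, fin_gen (A j).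

Lemma locally_iso T M M' : mod_iso M M' -> locally T M -> locally T M'.
Proof.
move=> [f /bij_lin_inv[g [fg gf]]] lM N a fN; have [B [b [d [TB dI db]]]] := lM N (g \o a) fN.
exists B, b, (f \o d); split=> // [x y /= /(can_inj fg)/dI //|x].
by rewrite /= db /= gf.
Qed.

(** Enlarge [N] by a free module so that it maps onto [A j]. The kernel is finitely generated, so
    its image lies in some [B'] in [filt A] inside [M']; the sum of [B'] and the image of the
    enlarged [N] is an extension of [A j] by [B']. *)
Lemma locally_filt_ext M' M j (f : {linear M' -> M}) (g : {linear M -> A j}) :
  ses f g -> locally (filt A) M' -> locally (filt A) M.
Proof.
move=> [fI ex gs] lM' N a fN.
have [m [e es]] := fin_gen_cover (fA j).
have [l lP] := @free_projective _ _ _ _ g e gs.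
pose a2 := lin_copair a l.
have ga2s : mod_surjective (g \o a2).
  by move=> y; have [z ez] := es y; exists (0, z); rewrite /= linear0 add0r lP.
have [N3 [k sk]] := ses_ker ga2s; have [kI exk _] := sk.
have fN2 : fin_gen (N * freemod R 'I_m)%type by apply: fin_gen_prod => //; exact: fin_gen_free.
have [a3 a3P] : exists a3 : {linear N3 -> M'}, forall x, f (a3 x) = (a2 \o k) x.
  by apply: factor_inj => // x; apply/ex; exact: (ses_zero sk).
have [B' [b' [d' [FB' dI' db']]]] := lM' N3 a3 (fin_gen_sub finR kI fN2).
have [B [q [i [qs iI iq]]]] := ex_image (lin_copair (f \o d') a2).
pose v := q \o lin_pair \0 (lin_pair idfun \0 : {linear N -> (N * freemod R 'I_m)%type}).
exists B, v, i; split=> //; last first.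
  by move=> x; rewrite /v /= iq /= !linear0 add0r addr0.
pose u := q \o lin_pair idfun \0 : {linear B' -> B}.
have uP x : i (u x) = f (d' x) by rewrite /u /= iq /= !linear0 !addr0.
have a2E z : i (q (0, z)) = a2 z by rewrite iq /= !linear0 add0r.
apply: (filt_ext (f := u) (g := g \o i)) => //; split.
- by move=> x y xy; apply: dI'; apply: fI; rewrite -!uP xy.
- move=> x; split=> [|[y <-]]; last by rewrite /= uP; apply/ex; exists (d' y).
  have [[y z] <-] := qs x; rewrite /= iq /= linearD => e0.
  have /exk[w kw] : (g \o a2) z = 0.
    by move: e0; rewrite (_ : g (f (d' y)) = 0) ?add0r //; apply/ex; exists (d' y).
  exists (y + b' w); apply: iI; rewrite uP iq /= !linearD /= db' a3P /= kw.
  by [].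
- move=> y; have [z gz] := ga2s y; exists (q (0, z)).
  by rewrite -gz /= a2E.
Qed.

(** A finitely generated module meets only finitely many summands of the top layer; these are added
    one at a time. *)
Lemma sfilt_locally M : sfilt A M -> locally (filt A) M.
Proof.
elim=> [{}M M0|M' {}M I c f g s _ IH].
  by move=> N a fN; exists M, a, idfun; split=> //; exact: filt_zero.
have [fI ex gs] := s.
have Hs (t : seq I) : smod (fun x => forall i, i \notin t -> dpr _ i (g x) = 0).
  split=> [i _|x y hx hy i ti|a x hx i ti]; rewrite ?linear0 ?linearD ?linearZ //=.
    by rewrite hx ?hy ?addr0.
  by rewrite hx ?scaler0.
suff H t : uniq t -> forall K (k : {linear K -> M}), injective k ->
    (forall x, (forall i, i \notin t -> dpr _ i (g x) = 0) <-> exists y, k y = x) ->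
    locally (filt A) K.
  move=> N a fN; have [t tP] := fin_gen_dsum_supp (g \o a) fN.
  have [K [k [kI kP]]] := ex_sub (Hs (undup t)).
  have [a' a'P] : exists a' : {linear N -> K}, forall x, k (a' x) = a x.
    by apply: factor_inj => // x; apply/kP => i; rewrite mem_undup; apply: tP.
  have [B [b [d [FB dI db]]]] := H _ (undup_uniq t) K k kI kP N a' fN.
  by exists B, b, (k \o d); split=> // [x y /= /kI/dI //|x]; rewrite /= db.
elim: t => [|i t IHt] /= ut K k kI kP.
  have [u uP] : exists u : {linear M' -> K}, forall x, k (u x) = f x.
    by apply: factor_inj => // x; apply/kP => i _; rewrite (ses_zero s) linear0.
  apply: locally_iso IH; exists u; apply: inj_surj_bij.
    by move=> x y e; apply: fI; rewrite -!uP e.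
  move=> y; have /ex[x fx] : g (k y) = 0.
    by apply: dsum_ext => i; rewrite linear0; apply: (proj2 (kP (k y))) => //; exists y.
  by exists x; apply: kI; rewrite uP.
have /andP[it {}ut] := ut.
have [K' [k' [kI' kP']]] := ex_sub (Hs t).
have [u uP] : exists u : {linear K' -> K}, forall x, k (u x) = k' x.
  apply: factor_inj => // x; apply/kP => i'; rewrite inE negb_or => /andP[_ it'].
  by apply: (proj2 (kP' _)) => //; exists x.
apply: (locally_filt_ext (j := c i) (f := u) (g := dpr _ i \o (g \o k))) (IHt ut K' k' kI' kP').
split.
- by move=> x y xy; apply: kI'; rewrite -!uP xy.
- move=> x; split=> [/= gx|[y <-]]; last by rewrite /= uP; apply: (proj2 (kP' _)) => //; exists y.
  have /kP'[y ky] : forall i', i' \notin t -> dpr _ i' (g (k x)) = 0.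
    move=> i' it'; have [->//|ne] := eqVneq i' i.
    by apply: (proj2 (kP (k x))); [exists x | rewrite inE negb_or ne].
  by exists y; apply: kI; rewrite uP.
- move=> y; have [x gx] := gs (dinj (fun i => A (c i)) i y).
  have /kP[z kz] : forall i', i' \notin i :: t -> dpr _ i' (g x) = 0.
    move=> i'; rewrite inE negb_or => /andP[ne _].
    by rewrite gx dpr_dinj_neq // eq_sym.
  by exists z; rewrite /= kz gx dpr_dinj.
Qed.

Lemma free_locally (I : eqType) :
  locally (fun B => exists m, B = freemod R 'I_m) (freemod R I).
Proof.
move=> N a fN; have [s0 s0P] := fin_gen_dsum_supp a fN.
pose s := undup s0; pose e := tnth (in_tuple s).
have eI : injective e by apply/tuple_uniqP; exact: undup_uniq.
have [d dP] := free_lift (fun t : 'I_(size s) => fbas R (e t)).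
have [p pP] := free_lift (fun x : I => if [pick t | e t == x] is Some t then fbas R t else 0).
have pd : cancel d p.
  apply: (free_hom_ext (f := p \o d) (g := idfun)) => t /=; rewrite dP pP.
  by case: pickP => [t' /eqP/eqP/eqP/eI -> //|/(_ t)]; rewrite eqxx.
exists (freemod R 'I_(size s)), (p \o a), d; split=> [||x]; first by exists (size s).
  exact: can_inj pd.
have := @free_hom_ext_on _ _ _ (d \o p) idfun s (a x); apply=> [i|i si] /=.
  by rewrite mem_undup; apply: s0P.
have /tnthP[t ->] : i \in in_tuple s by [].
by rewrite pP; case: pickP => [t' /eqP et|/(_ t)]; rewrite ?eqxx // dP et.
Qed.

End FiniteFiltrations.

(** * Finite projective dimension and the factorization property *)

Section FactorizationInduction.
Variable R : pzRingType.
Implicit Types B C D E F K M N P Q X Y Z W : lmodType R.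
Hypothesis finR : finlen (R^o : lmodType R).
Variables (n : nat) (S A Yk : 'I_n -> lmodType R).
Hypothesis repS : simple_representatives S.
Variables (jk : forall t, {linear Yk t -> A t}) (fk : forall t, {linear A t -> S t}).
Hypothesis sk : forall t, ses (jk t) (fk t).
Hypothesis CA : forall t, Pinfmod (A t).
Hypothesis extY : forall t B, Pinfmod B -> ext10 B (Yk t).
Hypothesis endoY : forall t, endofin (Yk t).

Lemma factors_retract (T : lmodType R -> Prop) X M :
  retract X M -> factors_through T M -> factors_through T X.
Proof.
move=> [s [r sr]] fM N a fN; have [B [b [d [TB db]]]] := fM N (s \o a) fN.
by exists B, b, (r \o d); split=> // x; rewrite /= db /= sr.
Qed.

Lemma locally_factors (T T' : lmodType R -> Prop) M :
  (forall B, T B -> T' B) -> locally T M -> factors_through T' M.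
Proof.
move=> TT' lM N a fN; have [B [b [d [TB _ db]]]] := lM N a fN.
by exists B, b, d; split=> //; apply: TT'.
Qed.

Lemma factors_retract_sfilt X : factors_through (@Pinfmod R) X ->
  exists2 C, sfilt A C & retract X C.
Proof.
move=> fX.
have [C [Y [i [p [s FC FY]]]]] := sfilt_approximation finR sk CA extY (sfilt_simple repS finR X).
have [|t tp] := factors_ext10 endoY _ fX FY s idfun.
  by move=> B I c; exact: (ext10_dsumY finR extY).
by exists C => //; exists t, p.
Qed.

Lemma projective_factors P : projective_mod P -> factors_through (@Pinfmod R) P.
Proof.
move=> /projective_free rP; apply: factors_retract rP _.
apply: locally_factors (@free_locally R P) => B [m ->]; exact: Pinf_free.
Qed.

(* Writing [X = P / K] with [K] a retract of a locally [filt A] module [C], the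
   embedding [c |-> (r c, c - s (r c))] of [C] into [P + C] has cokernel
   [X + K]; now both [C] and [P + C] are unions of finitely generated modules of
   finite projective dimension. *)
Lemma coker_factors K P X (i : {linear K -> P}) (q : {linear P -> X}) C :
  ses i q -> projective_mod P -> retract K C -> locally (filt A) C ->
  factors_through (@Pinfmod R) X.
Proof.
move=> [iI ex qs] pP [s [r sr]] lC N a fN.
have [t [pi tpi]] := projective_free pP.
pose F := freemod R P.
pose j : {linear C -> (F * C)%type} := lin_pair (t \o i \o r) (idfun \- (s \o r)).
have jI : injective j.
  apply: inj_of_ker => c [] /(congr1 pi) /=; rewrite tpi linear0 => irc.
  have rc : r c = 0 by apply: iI; rewrite irc linear0.
  by rewrite rc linear0 subr0.
pose kap : {linear (F * C)%type -> X} := lin_copair (q \o pi) \0.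
have kj c : kap (j c) = 0.
  by rewrite /kap /= tpi addr0; apply/ex; exists (r c).
have [m [e es]] := fin_gen_cover fN.
have [N0 [nu sN]] := ses_ker es; have [nuI exN _] := sN.
have fL := @fin_gen_free R m.
have [l lP] := @free_projective _ _ _ _ q (a \o e) qs.
have [rho rhoP] : exists rho : {linear N0 -> K}, forall x, i (rho x) = (l \o nu) x.
  by apply: factor_inj => // x; apply/ex; rewrite /= lP /= (ses_zero sN) linear0.
have [U0 [b0 [d0 [FU0 d0I db0]]]] := lC N0 (s \o rho) (fin_gen_sub finR nuI fL).
have fN2 : fin_gen (freemod R 'I_m * U0)%type by apply: fin_gen_prod => //; case: FU0.
have [F1 [b1 [d1 [[m1 eF1] d1I db1]]]] :=
  @free_locally R P _ (lin_copair (t \o l) (fst \o j \o d0)) fN2.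
have [B [b2 [d2 [FB d2I db2]]]] := lC _ (lin_copair \0 (snd \o j \o d0)) fN2.
pose v := lin_pair b1 b2.
pose D : {linear (F1 * B)%type -> (F * C)%type} := lin_prod d1 d2.
have DI : injective D by move=> [x1 x2] [y1 y2] [] /d1I-> /d2I->.
have Dv z : D (v z) = (t (l z.1) + (j (d0 z.2)).1, (j (d0 z.2)).2).
  by congr (_, _); rewrite /= ?db1 ?db2 //= add0r.
pose u := v \o lin_pair \0 idfun : {linear U0 -> (F1 * B)%type}.
have Du x : D (u x) = j (d0 x).
  by rewrite -[u x]/(v (0, x)) Dv /= !linear0 add0r.
clearbody v; have uI : injective u by move=> x y e'; apply: d0I; apply: jI; rewrite -!Du e'.
(* [W] is a finitely generated model of the cokernel of [j]; it lies in [Pinfmod] because [U0], [F1]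
   and [B] do. *)
have [W [om sW]] := ses_coker uI; have [_ exW oms] := sW.
have PW : Pinfmod W.
  apply: (Pinf_coker sW); first exact: (filt_Pinf CA).
  by apply: Pinf_prod; [rewrite eF1; exact: Pinf_free | exact: (filt_Pinf CA)].
have [la laP] : exists la : {linear W -> X}, forall y, la (om y) = (kap \o D) y.
  by apply: factor_surj => // y /exW[x <-]; rewrite -[LHS]/(kap (D (u x))) Du kj.
pose w0 := om \o v \o lin_pair idfun \0 : {linear freemod R 'I_m -> W}.
have w0E y : w0 y = om (v (y, 0)) by [].
(* On the relations [N0] the map [w0] vanishes: as [r \o s] is the identity, [j] sends [s (rho z)]
   to a pair with second component zero, and this pair comes from [U0]. *)
have [b bP] : exists b : {linear N -> W}, forall y, b (e y) = w0 y.
  apply: factor_surj => // y /exN[z <-]; rewrite w0E; apply/exW; exists (b0 z).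
  apply: DI; rewrite Du Dv db0 /= !linear0 addr0 sr subrr.
  by rewrite rhoP /= addr0.
exists W, b, la; split=> // x; have [y <-] := es x.
rewrite bP w0E laP -[LHS]/(kap (D (v (y, 0)))) Dv /= !linear0 !addr0 tpi.
exact: lP.
Qed.

Lemma pdle_factors m X : pdle m X -> factors_through (@Pinfmod R) X.
Proof.
elim: m X => [|m IH] X /=; first exact: projective_factors.
move=> [P [K [i [q [pP s pK]]]]].
have [C FC rC] := factors_retract_sfilt (IH K pK).
apply: coker_factors s pP rC _.
by apply: (sfilt_locally finR) => // j; case: (CA j).
Qed.

(** In the converse direction the bound on the projective dimension of [X] is a common bound for the
    [A t], independent of [X]. *)
Lemma PinfMod_factors X : PinfMod X <-> factors_through (filt A) X.
Proof.
split=> [/finite_pdP[m /pdle_factors/factors_retract_sfilt[C FC rC]]|fX].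
  apply: factors_retract rC _; apply: (@locally_factors (filt A)) => //.
  by apply: (sfilt_locally finR) => // j; case: (CA j).
have [|C FC rC] := @factors_retract_sfilt X.
  move=> N a fN; have [B [b [d [FB db]]]] := fX N a fN.
  by exists B, b, d; split=> //; exact: (filt_Pinf CA).
have /choice[p pP] t : exists p, pdle p (A t) by apply/finite_pdP; case: (CA t).
apply/finite_pdP; exists (\max_t p t); apply: pdle_retract rC _.
by apply: sfilt_pdle FC => t; apply: pdle_leq (pP t); exact: leq_bigmax.
Qed.

End FactorizationInduction.

(** * Direct limits *)

Section Lazard.
Variables (R : pzRingType) (X : lmodType R).
Local Notation T := (X * nat)%type.
Local Notation F := (freemod R T).
Local Notation coord := (dpr (fun _ : T => R^o : lmodType R)).
Local Open Scope classical_set_scope.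

Definition supp_in (s : seq T) : set F := fun y => forall i, i \notin s -> coord i y = 0.

Lemma supp_in_smod s : smod (supp_in s).
Proof.
split=> [i _|x y hx hy i ti|a x hx i ti]; rewrite ?linear0 ?linearD ?linearZ //=.
  by rewrite hx ?hy ?addr0.
by rewrite hx ?scaler0.
Qed.

Lemma supp_in_sub s s' : {subset s <= s'} -> supp_in s `<=` supp_in s'.
Proof. by move=> ss y ys i ni; apply: ys; apply: contra ni; apply: ss. Qed.

Lemma supp_in_fbas (s : seq T) i : i \in s -> supp_in s (fbas R i).
Proof. by move=> si j nj; apply: dpr_dinj_neq; apply: contraNneq nj => <-. Qed.

Lemma supp_in_basis (s : seq T) : uniq s -> exists d : {linear freemod R 'I_(size s) -> F},
  (forall t, d (fbas R t) = fbas R (tnth (in_tuple s) t)) /\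
  forall y, supp_in s y -> exists z, d z = y.
Proof.
move=> us; have [d dP] := free_lift (fun t : 'I_(size s) => fbas R (tnth (in_tuple s) t)).
exists d; split=> // y ys; rewrite (dsum_decomp us ys).
apply: (smod_sum _ (smod_range d)) => i.
case: (boolP (i \in s)) => [si|/ys->]; last by exists 0; rewrite !linear0.
have /tnthP[t ->] : i \in in_tuple s by [].
exists ((dpr _ (tnth (in_tuple s) t) y : R) *: fbas R t).
by rewrite linearZ /= dP dinj_fbas.
Qed.

Variable C : lmodType R -> Prop.
Hypothesis C_iso : forall B B', mod_iso B B' -> C B -> C B'.
Hypothesis C_fg : forall B, C B -> fin_gen B.
Hypothesis factX : factors_through C X.
Variable pi : {linear F -> X}.
Hypothesis piP : forall i, pi (fbas R i) = i.1.

(* The stages are the quotients of finitely generated free submodules of [F] that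
   lie over [X] and belong to [C]. *)
Record stage := Stage {
  st_supp : seq T;
  st_rel : set F;
  st_smod : smod st_rel;
  st_sub : st_rel `<=` supp_in st_supp;
  st_ker : forall y, st_rel y -> pi y = 0;
  st_C : C (factmod (mksub (supp_in_smod st_supp)) (mksub st_smod))
}.

HB.instance Definition _ := gen_eqMixin stage.
HB.instance Definition _ := gen_choiceMixin stage.

Definition stage_le (i j : stage) : bool :=
  `[< {subset st_supp i <= st_supp j} /\ st_rel i `<=` st_rel j >].

Fact stage_le_refl : reflexive stage_le.
Proof. by move=> i; apply/asboolP; split. Qed.

Fact stage_le_trans : transitive stage_le.
Proof.
move=> j i l /asboolP[s1 r1] /asboolP[s2 r2]; apply/asboolP.
split; last exact: subset_trans r2.
by move=> x xi; apply: s2; apply: s1.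
Qed.

Fact stage_display : Order.disp_t. Proof. exact: (Order.Disp tt tt). Qed.

HB.instance Definition _ := Order.Le_isPreorder.Build stage_display stage
  stage_le_refl stage_le_trans.

Lemma stage_leP (i j : stage) : (i <= j)%O ->
  {subset st_supp i <= st_supp j} /\ st_rel i `<=` st_rel j.
Proof. by move=> /asboolP. Qed.

(* The copies [(x, 0), (x, 1), ...] of each [x] provide fresh basis elements on
   which to put the generators of [B]. *)
Lemma stage_above (s : seq T) (K : set F) : smod K -> K `<=` supp_in s ->
  (forall y, K y -> pi y = 0) ->
  exists i : stage, {subset s <= st_supp i} /\ K `<=` st_rel i.
Proof.
move=> HK Ks Kpi; pose s1 := undup s.
have [d [dP dS]] := supp_in_basis (undup_uniq s : uniq s1).
have ss1 : supp_in s `<=` supp_in s1 by apply: supp_in_sub => i; rewrite mem_undup.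
have [N [w [ws wK]]] := ex_quot (smod_preim d HK).
have [a aP] : exists a : {linear N -> X}, forall z, a (w z) = (pi \o d) z.
  by apply: factor_surj => // z /wK/Kpi.
have [B [g [h [CB hg]]]] := factX a (fin_gen_surj ws (@fin_gen_free _ _)).
have [r [b bP]] := C_fg CB.
(* Copy numbers from [n0] on do not occur in [s1], so the [f q] are fresh; the offset [q] keeps them
   distinct even when generators have equal images in [X]. *)
pose n0 := (\max_(i <- s1) i.2).+1.
pose e (t : 'I_(size s1)) := tnth (in_tuple s1) t.
pose f (q : 'I_r) : T := (h (b q), n0 + q)%N.
have eI : injective e by apply/tuple_uniqP; exact: undup_uniq.
have fI : injective f by move=> q q' [_ /addnI/val_inj].
have ef t q : e t != f q.
  apply/eqP => etq; have : (n0 <= (e t).2)%N by rewrite etq leq_addr.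
  by rewrite ltnNge leq_bigmax_seq // mem_tnth.
have [rho rhoP] := free_lift (fun x : T => if [pick t | e t == x] is Some t then g (w (fbas R t))
  else if [pick q | f q == x] is Some q then b q else 0).
have rhoe t : rho (fbas R (e t)) = g (w (fbas R t)).
  by rewrite rhoP; case: pickP => [t' /eqP/eI-> //|/(_ t)]; rewrite eqxx.
have rhof q : rho (fbas R (f q)) = b q.
  rewrite rhoP; case: pickP => [t /eqP etq|_]; first by have := ef t q; rewrite etq eqxx.
  by case: pickP => [q' /eqP/fI-> //|/(_ q)]; rewrite eqxx.
pose s2 := s1 ++ [seq f q | q <- enum 'I_r].
have s12 : {subset s1 <= s2} by move=> i si; rewrite mem_cat si.
have hrho y : supp_in s2 y -> h (rho y) = pi y.
  move=> ys; apply: (free_hom_ext_on (f := h \o rho) (g := pi) ys) => i.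
  rewrite mem_cat => /orP[si|/mapP[q _ ->]] /=; last by rewrite rhof piP.
  have /tnthP[t ->] : i \in in_tuple s1 by [].
  by rewrite -/(e t) rhoe hg aP /= dP.
have rhod z : rho (d z) = g (w z).
  by apply: (free_hom_ext (f := rho \o d) (g := g \o w)) => t /=; rewrite dP rhoe.
(* The new relations are the kernel of [rho] on the enlarged free module, so the new stage is
   isomorphic to [B]. *)
have HK2 := smodI (supp_in_smod s2) (smod_ker rho).
have K2s : (fun y => supp_in s2 y /\ rho y = 0) `<=` supp_in s2 by move=> y [].
have K2pi y : supp_in s2 y /\ rho y = 0 -> pi y = 0.
  by case=> /hrho <- ->; exact: linear0.
have CQ : C (factmod (mksub (supp_in_smod s2)) (mksub HK2)).
  apply: C_iso CB; apply: (@section_unique _ F (supp_in s2) (fun y => supp_in s2 y /\ rho y = 0)).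
    have [U [k [kI kU]]] := ex_sub (supp_in_smod s2).
    exists U, k, (rho \o k); split=> // [y|x]; last first.
      by split=> [rk|[]//]; split=> //; apply/kU; exists x.
    have [cc ->] := bP y.
    have /kU[x kx] : supp_in s2 (\sum_(q < r) cc q *: fbas R (f q)).
      apply: (smod_sum _ (supp_in_smod s2)) => q; have [_ _ UZ] := supp_in_smod s2; apply: UZ.
      by apply: supp_in_fbas; rewrite mem_cat map_f ?orbT // mem_enum.
    exists x; rewrite /= kx linear_sum; apply: eq_bigr => q _.
    by rewrite linearZ /= rhof.
  have := factmod_section (mksub (supp_in_smod s2)) (mksub HK2).
  have e1 (U : set F) (HU : smod U) : ((fun x => x \in mksub HU) : set F) = U.
    by apply/seteqP; split=> x /mksubP.
  by rewrite !e1.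
exists (Stage K2s K2pi CQ); split=> /= [i si|y Ky].
  by apply: s12; rewrite mem_undup.
have y1 := ss1 _ (Ks _ Ky); split; first exact: supp_in_sub y1.
have [z dz] := dS _ y1; rewrite -dz rhod.
have -> : w z = 0 by apply/wK; rewrite dz.
exact: linear0.
Qed.

Definition stage_obj (i : stage) : lmodType R :=
  factmod (mksub (supp_in_smod (st_supp i))) (mksub (st_smod i)).

Definition stage_pi (i : stage) :
  {linear submod_of (mksub (supp_in_smod (st_supp i))) -> stage_obj i} :=
  projT1 (cid (factmod_pi (mksub (supp_in_smod (st_supp i))) (mksub (st_smod i)))).

Lemma stage_pi_surj i : mod_surjective (stage_pi i).
Proof. by rewrite /stage_pi; case: cid => ? []. Qed.

Lemma stage_pi0 i x : stage_pi i x = 0 <-> st_rel i (val x).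
Proof.
rewrite /stage_pi; case: cid => g [_ gP] /=; rewrite gP.
by split=> [/mksubP|h]; last exact/mksubP.
Qed.

Lemma stage_elt i y : supp_in (st_supp i) y ->
  exists x : submod_of (mksub (supp_in_smod (st_supp i))), val x = y.
Proof. by move=> ys; exists (Submod (introT (mksubP _ y) ys)). Qed.

Lemma stage_supp i (x : submod_of (mksub (supp_in_smod (st_supp i)))) :
  supp_in (st_supp i) (val x).
Proof. by have /mksubP := valP x. Qed.

Lemma stage_pi_eq i x y : val x = val y -> stage_pi i x = stage_pi i y.
Proof. by move=> e; congr (stage_pi i _); exact: val_inj. Qed.

Lemma stage_map_exists i j : (i <= j)%O -> exists f : {linear stage_obj i -> stage_obj j},
  forall x y, val x = val y -> f (stage_pi i x) = stage_pi j y.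
Proof.
move=> /stage_leP[ss rr].
have [u uP] : exists u : {linear submod_of (mksub (supp_in_smod (st_supp i))) ->
    submod_of (mksub (supp_in_smod (st_supp j)))}, forall x, val (u x) = val x.
  apply: (factor_inj (f := (val : {linear submod_of (mksub (supp_in_smod (st_supp j))) -> F})) (h := (val : {linear _ -> F}))).
    exact: val_inj.
  by move=> x; apply: stage_elt; exact: supp_in_sub ss _ (stage_supp x).
have [f fP] : exists f : {linear stage_obj i -> stage_obj j}, forall x, f (stage_pi i x) = (stage_pi j \o u) x.
  apply: (factor_surj (@stage_pi_surj i)) => x /stage_pi0/rr xr.
  by apply/stage_pi0; rewrite uP.
exists f => x y e; rewrite fP /=; apply: stage_pi_eq; by rewrite uP.
Qed.

Definition stage_map i j (ij : (i <= j)%O) : {linear stage_obj i -> stage_obj j} :=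
  projT1 (cid (stage_map_exists ij)).

Lemma stage_mapP i j (ij : (i <= j)%O) x y : val x = val y ->
  stage_map ij (stage_pi i x) = stage_pi j y.
Proof. by rewrite /stage_map; case: cid => f fP; apply: fP. Qed.

Fact stage_nonempty : inhabited stage.
Proof.
have [||i _] := @stage_above [::] (fun y => y = 0) (smod_ker idfun).
- by move=> _ -> j _; rewrite linear0.
- by move=> _ ->; rewrite linear0.
- by [].
Qed.

Fact stage_directed (i j : stage) : exists k, (i <= k)%O /\ (j <= k)%O.
Proof.
have [||k [sk rk]] := @stage_above (st_supp i ++ st_supp j) _ (smod_add (st_smod i) (st_smod j)).
- move=> y [u /st_sub ui vj]; rewrite -(subrK u y); have [_ UD _] := supp_in_smod (st_supp i ++ st_supp j).
  apply: UD; first by apply: supp_in_sub (st_sub vj) => l; rewrite mem_cat orbC => ->.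
  by apply: supp_in_sub ui => l; rewrite mem_cat => ->.
- by move=> y [u /st_ker pu /st_ker]; rewrite linearB /= pu subr0.
exists k; split; apply/asboolP; split=> x xs.
- by apply: sk; rewrite mem_cat xs.
- by apply: rk; exists x => //; rewrite subrr; case: (st_smod j).
- by apply: sk; rewrite mem_cat xs orbT.
- by apply: rk; exists 0; [case: (st_smod i) | rewrite subr0].
Qed.

Fact stage_map_id i (ii : (i <= i)%O) x : stage_map ii x = x.
Proof. by have [y <-] := stage_pi_surj x; exact: stage_mapP. Qed.

Fact stage_map_comp i j l (ij : (i <= j)%O) (jl : (j <= l)%O) (il : (i <= l)%O) x :
  stage_map jl (stage_map ij x) = stage_map il x.
Proof.
have [y <-] := stage_pi_surj x.
have [ss _] := stage_leP ij; have [ss' _] := stage_leP jl.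
have ys := stage_supp y.
have [y1 e1] := stage_elt (supp_in_sub ss ys).
have [y2 e2] := stage_elt (supp_in_sub ss' (supp_in_sub ss ys)).
rewrite (@stage_mapP _ _ ij y y1) // (@stage_mapP _ _ jl y1 y2) ?(@stage_mapP _ _ il y y2) //.
by rewrite e1.
Qed.

Definition stage_system : directed_system R :=
  DirectedSystem stage_nonempty stage_directed stage_map_id stage_map_comp.

(** Each element of [F] lies in some stage, and each element of the kernel of [pi] becomes a
    relation in some stage. Compatible maps on the stages therefore define a map on [F] that factors
    through [pi]. *)
Lemma stage_limit : direct_limits_of C X.
Proof.
exists stage_system; first by move=> i; exact: st_C.
have ex_psi (i : stage) : exists p : {linear stage_obj i -> X}, forall x, p (stage_pi i x) = pi (val x).
  apply: (factor_surj (h := pi \o val) (@stage_pi_surj i)) => x /stage_pi0.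
  exact: st_ker.
have [psi psiP] := dep_choice ex_psi.
have cover y : exists i : stage, supp_in (st_supp i) y.
  have [s sy] := dsum_supp y.
  have [||i [si _]] := @stage_above s (fun y => y = 0) (smod_ker idfun).
  - by move=> _ -> j _; rewrite linear0.
  - by move=> _ ->; rewrite linear0.
  - by exists i; apply: supp_in_sub sy.
have pis x : pi (fbas R (x, 0%N)) = x by rewrite piP.
exists psi; split=> [i j ij z|Y chi chiC].
  have [x <-] := stage_pi_surj z; have [ss _] := stage_leP ij.
  have [y e] := stage_elt (supp_in_sub ss (stage_supp x)).
  by rewrite /= (@stage_mapP _ _ ij x y) // !psiP e.
have uniq i j (x : submod_of (mksub (supp_in_smod (st_supp i)))) (y : submod_of (mksub (supp_in_smod (st_supp j)))) :
    val x = val y -> chi i (stage_pi i x) = chi j (stage_pi j y).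
  move=> e; have [k [ik jk]] := stage_directed i j.
  have [ss _] := stage_leP ik; have [z ez] := stage_elt (supp_in_sub ss (stage_supp x)).
  rewrite -(chiC _ _ ik) -(chiC _ _ jk) /=.
  by rewrite (@stage_mapP _ _ ik x z) // (@stage_mapP _ _ jk y z) // ez.
have /choice[c cP] (y : F) : exists z, forall i (x : submod_of (mksub (supp_in_smod (st_supp i)))),
    val x = y -> chi i (stage_pi i x) = z.
  have [i si] := cover y; have [x ex] := stage_elt si.
  by exists (chi i (stage_pi i x)) => j x' e; apply: uniq; rewrite e ex.
have cl : linear c.
  move=> a y1 y2; have [i1 s1] := cover y1; have [i2 s2] := cover y2.
  have [k [/stage_leP[k1 _] /stage_leP[k2 _]]] := stage_directed i1 i2.
  have [x1 e1] := stage_elt (supp_in_sub k1 s1).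
  have [x2 e2] := stage_elt (supp_in_sub k2 s2).
  rewrite -(cP y1 _ x1 e1) -(cP y2 _ x2 e2) -!linZD; symmetry; apply: cP.
  by rewrite /= e1 e2.
have [u uP] : exists u : {linear X -> Y}, forall y, u (pi y) = mklin cl y.
  apply: factor_surj => [x|y piy /=]; first by exists (fbas R (x, 0%N)).
  have [s sy] := dsum_supp y.
  (* The multiples of [y] are imposed as relations at some stage. *)
  have [||i [si ri]] := @stage_above s _ (smod_range (linscale y)).
  - by move=> _ [a <-] j /sy yj; rewrite /= linearZ /= yj scaler0.
  - by move=> _ [a <-]; rewrite /= linearZ /= piy scaler0.
  have [x ex] := stage_elt (supp_in_sub si sy).
  rewrite -(cP y i x ex) (_ : stage_pi i x = 0) ?linear0 //.
  by apply/stage_pi0/ri; exists 1; rewrite /= scale1r.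
split=> [|v1 v2 v1P v2P x].
  exists u => i z; have [x <-] := stage_pi_surj z.
  by rewrite psiP uP /=; symmetry; apply: cP.
have [i si] := cover (fbas R (x, 0%N)); have [y ey] := stage_elt si.
have <- : psi i (stage_pi i y) = x by rewrite psiP ey.
by rewrite v1P v2P.
Qed.

End Lazard.

Lemma factors_direct_limit (R : pzRingType) (C : lmodType R -> Prop) (X : lmodType R) :
  (forall B B', mod_iso B B' -> C B -> C B') -> (forall B, C B -> fin_gen B) ->
  factors_through C X -> direct_limits_of C X.
Proof.
move=> Ci Cf fX; have [p pP] := free_lift (fun i : X * nat => i.1).
exact: (stage_limit Ci Cf fX pP).
Qed.

(** * Maps from finitely generated modules to direct limits *)

Section DirectLimits.
Variable R : pzRingType.
Implicit Types N X Y : lmodType R.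
Variables (D : directed_system R) (X : lmodType R) (psi : forall i, {linear D i -> X}).
Hypothesis limX : is_direct_limit psi.
Local Open Scope classical_set_scope.

(** The projection onto the quotient by the union of the images agrees with zero on every [D i], so
    the uniqueness part of the universal property makes it zero. *)
Lemma limit_surj x : exists i d, psi i d = x.
Proof.
have [co univ] := limX.
have HU : smod (fun x => exists i d, psi i d = x).
  split=> [|_ _ [i [d <-]] [j [d' <-]]|a _ [i [d <-]]].
  - by have [i] := ds_nonempty D; exists i, 0; rewrite linear0.
  - have [k [ik jk]] := ds_directed i j.
    by exists k, (ds_map ik d + ds_map jk d'); rewrite linearD !co.
  - by exists i, (a *: d); rewrite linearZ.
have [Q [g [_ gP]]] := ex_quot HU.
have [|_ uni] := univ Q (fun i => \0); first by [].
apply/gP; rewrite (uni g \0) //= => i d; by apply/gP; exists i, d.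
Qed.

(* A direct limit maps to the product of the [D j] modulo eventual equality. *)
Lemma limit_ker i (d : D i) : psi i d = 0 -> exists j (ij : (i <= j)%O), ds_map ij d = 0.
Proof.
have [co univ] := limX.
have HU : smod (fun y : dprod D => exists k, forall j, (k <= j)%O -> y j = 0).
  split=> [|x y [k kx] [l ly]|a x [k kx]].
  - by have [k] := ds_nonempty D; exists k.
  - have [m [km lm]] := ds_directed k l; exists m => j mj.
    by rewrite -[LHS]/(x j + y j) kx ?ly ?addr0 //; exact: Order.PreorderTheory.le_trans mj.
  - by exists k => j kj; rewrite -[LHS]/(a *: x j) kx ?scaler0.
have [Q [g [_ gP]]] := ex_quot HU.
(* The default value at indices not above [i] is immaterial modulo eventual equality; it only makes
   [tau] total. *)
pose tau i (d : D i) : dprod D := fun j => if @idP (i <= j)%O is ReflectT ij then ds_map ij d else 0.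
have tauE k (d' : D k) j (kj : (k <= j)%O) : tau k d' j = ds_map kj d'.
  rewrite /tau; case: {-}_ / idP => [kj'|//].
  by congr (ds_map _ d'); exact: bool_irrelevance.
have tau_lin k : linear (tau k).
  move=> a x y; apply: functional_extensionality_dep => j.
  rewrite -[RHS]/(a *: tau k x j + tau k y j) /tau.
  by case: {-}_ / idP => [kj|_]; rewrite ?linZD // scaler0 addr0.
have [|[u uP] _] := univ Q (fun k => g \o mklin (tau_lin k)).
  move=> k l kl x.
  have : g (tau l (ds_map kl x) - tau k x) = 0.
    apply/gP; exists l => j lj; have kj := Order.PreorderTheory.le_trans kl lj.
    rewrite -[LHS]/(tau l (ds_map kl x) j - tau k x j) !tauE.
    by rewrite (ds_map_comp kl lj kj) subrr.
  by rewrite linearB => /eqP; rewrite subr_eq0 => /eqP.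
move=> psid; have /gP[k kP] : g (tau i d) = 0 by rewrite -[LHS]uP psid linear0.
have [j [ij kj]] := ds_directed i k.
by exists j, ij; rewrite -tauE; exact: kP.
Qed.

Lemma ds_bound (I : eqType) (r : seq I) (P : I -> ds_index D -> Prop) :
  (forall i a b, (a <= b)%O -> P i a -> P i b) -> (forall i, exists a, P i a) ->
  exists k, forall i, i \in r -> P i k.
Proof.
move=> Pm Pe; elim: r => [|i r [k kP]]; first by have [k] := ds_nonempty D; exists k.
have [a Pa] := Pe i; have [b [ab kb]] := ds_directed a k.
by exists b => j; rewrite inE => /orP[/eqP->|/kP]; [apply: Pm Pa | apply: Pm].
Qed.

(** Over a ring of finite length [N] is finitely presented: its generators lift to one stage, and
    its finitely many relations hold at a later one. *)
Lemma limit_factors (C : lmodType R -> Prop) : finlen (R^o : lmodType R) ->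
  (forall i, C (D i)) -> factors_through C X.
Proof.
move=> finR CD N a fN; have [co _] := limX.
have [m [e es]] := fin_gen_cover fN.
have [N0 [nu sN]] := ses_ker es; have [nuI exN _] := sN.
have [||i iP] := @ds_bound _ (enum 'I_m) (fun t i => exists d, psi i d = a (e (fbas R t))).
- by move=> t k l kl [d <-]; exists (ds_map kl d); rewrite co.
- by move=> t; exact: limit_surj.
have /choice[d dP] t : exists d, psi i d = a (e (fbas R t)) by apply: iP; rewrite mem_enum.
have [phi phiP] := free_lift d.
have psiphi z : psi i (phi z) = a (e z).
  by apply: (free_hom_ext (f := psi i \o phi) (g := a \o e)) => t /=; rewrite phiP dP.
have [s sS] := proj1 (fin_genP N0) (fin_gen_sub finR nuI (@fin_gen_free R m)).
have [||j jP] := @ds_bound _ s (fun z j => exists ij : (i <= j)%O, ds_map ij (phi (nu z)) = 0).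
- move=> z k l kl [ik kz]; have il := Order.PreorderTheory.le_trans ik kl.
  by exists il; rewrite -(ds_map_comp ik kl) kz linear0.
- by move=> z; apply: limit_ker; rewrite psiphi (ses_zero sN) linear0.
have [k [ik jk]] := ds_directed i j.
have [b bP] : exists b : {linear N -> D k}, forall z, b (e z) = (ds_map ik \o phi) z.
  apply: factor_surj => // z /exN[z0 <-] /=.
  apply: (sS z0 _ (smod_ker (ds_map ik \o phi \o nu))) => y /= /jP[ij y0].
  by rewrite -(ds_map_comp ij jk) y0 linear0.
exists (D k), b, (psi k); split=> // x; have [z <-] := es x.
by rewrite bP /= co psiphi.
Qed.

End DirectLimits.

Section ApproximationsOfSimples.
Variables (k : comNzRingType) (L : algType k).
Hypothesis artinL : artin_algebra L.

(** The map [f] is onto: a nonzero map from a free module of rank one to [S] factors through it, so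
    its image is nonzero in the simple module [S]. *)
Lemma minimal_approximation_ses (S A : lmodType L) : simple_mod S ->
  minimal_approximation (@Pinfmod L) S A ->
  exists (Y : lmodType L) (j : {linear Y -> A}) (f : {linear A -> S}),
    [/\ ses j f, Pinfmod A, (forall B, Pinfmod B -> ext10 B Y) & endofin Y].
Proof.
have finL : finlen (L^o : lmodType L) := artin_finlen artinL (fin_gen_regular L).
move=> /simple_modP[[x xn] sm] /(wakamatsu finL)[f [CA [apf wak]]].
have fs : mod_surjective f.
  have [h0|//] := sm _ (smod_range f).
  have [p pP] := free_lift (fun _ : 'I_1 => x).
  have [h hP] := apf _ p (Pinf_free L 1).
  case/eqP: xn; rewrite -(pP ord0) hP; apply: h0.
  by exists (h (fbas L ord0)).
have [Y [j s]] := ses_ker fs; have [jI ex _] := s.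
exists Y, j, f; split=> //; first exact: wak jI ex.
by apply: (artin_endofin artinL); apply: (fin_gen_sub finL jI); case: CA.
Qed.

End ApproximationsOfSimples.

Theorem theorem4p4 (k : comNzRingType) (L : algType k)
    (artinL : artin_algebra L)
    (cfinL : contravariantly_finite (@Pinfmod L))
    (n : nat) (S A : 'I_n -> lmodType L)
    (repS : simple_representatives S)
    (minA : forall i, minimal_approximation (@Pinfmod L) (S i) (A i)) :
  (forall X : lmodType L, PinfMod X <-> direct_limits_of (filt A) X) /\
  (forall X : lmodType L, PinfMod X -> direct_limits_of (@Pinfmod L) X).
Proof.
have finL : finlen (L^o : lmodType L) := artin_finlen artinL (fin_gen_regular L).
have [simS _ _] := repS.
have [Y YP] := dep_choice (fun t => minimal_approximation_ses artinL (simS t) (minA t)).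
have [j jP] := dep_choice YP; have [f fP] := dep_choice jP.
have CA t : Pinfmod (A t) by case: (fP t).
have main X : PinfMod X <-> factors_through (filt A) X.
  by apply: (PinfMod_factors finL repS (Yk := Y) (jk := j) (fk := f)) => t; case: (fP t).
have lim X : PinfMod X -> direct_limits_of (filt A) X.
  move=> /main; apply: factors_direct_limit => [B B'|B []//]; exact: filt_iso.
split=> X; first split=> [|[D FD [psi limX]]]; first exact: lim.
  by apply/main; apply: (limit_factors limX finL (C := filt A)) FD.
move=> /lim[D FD limX]; exists D => // i; exact: filt_Pinf CA (FD i).
Qed.
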